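(* Let $\mathbb V$ be an $N_K=N$ SUSY vertex algebra, and let $\gamma$ be a complex number or a formal variable. Then the quotient space $$\widetilde A_\gamma(\mathbb V):=\mathbb V[\gamma]/\widetilde O_\gamma(\mathbb V),\qquad\widetilde O_\gamma(\mathbb V):=\mathrm{Span}_{\mathbb C[\gamma]}\{a\bullet^\gamma_n b\mid a,b\in\mathbb V,\ n\ge2\}$$ is an associative algebra whose product is induced by the operation $\bullet^\gamma_1$, i.e. $[a]\bullet^\gamma[b]:=[a\bullet^\gamma_1b]$ for $a,b\in\mathbb V$, and the class of the vacuum $\mathbf 1\in\mathbb V$ is its unit. Moreover, it is isomorphic to the Zhu algebra $\widetilde A_\gamma(\mathbb V_{\mathrm{red}})$ of the (non-SUSY) vertex algebra $\mathbb V_{\mathrm{red}}$, the reduced part of $\mathbb V$.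
   Context: Everything is over $\mathbb C$ and in the super sense. When $\gamma$ is a complex number, $\mathbb V[\gamma]$ means $\mathbb V$ and $\mathbb C[\gamma]$ means $\mathbb C$. Let $N\ge1$, $[N]=\{1,\dots,N\}$, $Z=(z,\zeta^1,\dots,\zeta^N)$ with $z$ an even and $\zeta^i$ odd indeterminates, $Z^{j|J}=z^j\zeta^{j_1}\cdots\zeta^{j_r}$ for $J=\{j_1<\dots<j_r\}\subset[N]$. For a superspace $\mathbb V$, $\mathbb V[[Z^{\pm1}]]=\mathbb V[[z^{\pm1}]][\zeta^1,\dots,\zeta^N]$, $\mathbb V((Z))=\mathbb V((z))[\zeta^1,\dots,\zeta^N]$. An $N_K=N$ SUSY vertex algebra (Heluani–Kac) is $(\mathbb V,Y,\mathbf 1,D^1,\dots,D^N)$: a superspace $\mathbb V$, an even linear map $a\mapsto Y(a,Z)=a(Z)=\sum_{j\in\mathbb Z,J\subset[N]}Z^{-1-j|[N]\setminus J}a_{(j|J)}\in(\mathrm{End}\,\mathbb V)[[Z^{\pm1}]]$, a nonzero even vector $\mathbf 1$, and odd operators $D^k$ on $\mathbb V$, such that for all $a,b$: (i) $a(Z)b\in\mathbb V((Z))$; (ii) $Y(\mathbf 1,Z)=\mathrm{id}$, $a(Z)\mathbf 1=a+O(Z)$, $D^k\mathbf 1=0$; (iii) $[D^k,a(Z)]=(\partial_{\zeta^k}-\zeta^k\partial_z)a(Z)$; (iv) $(z-w)^M[a(Z),b(W)]=0$ for some $M\in\mathbb N$. All $(D^k)^2$ coincide; $\partial:=(D^1)^2=\dots=(D^N)^2$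 is the even translation operator. Operations: for $a,b\in\mathbb V$, $n\ge1$, $$a\bullet^\gamma_nb:=\mathrm{Res}_z\Bigl[\frac{\gamma^ne^{\gamma z}}{(e^{\gamma z}-1)^n}a(z,0,\dots,0)b\Bigr]dz\quad(\gamma\neq0\text{ or formal}),\qquad a\bullet^{\gamma=0}_nb:=a_{(-n|[N])}b,$$ where for formal $\gamma$ the kernel is expanded in $\mathbb Q[\gamma]((z))$, so that $a\bullet^\gamma_nb\in\mathbb V[\gamma]$. Reduced part: $\mathbb V_{\mathrm{red}}$ is the vertex (super)algebra on $\mathbb V$ with fields $a(z)=a(z,0,\dots,0)=\sum_jz^{-j-1}a_{(j|[N])}$, vacuum $\mathbf 1$ and translation operator $\partial$. Zhu algebra of a vertex (super)algebra $V$: with $a\bullet^\gamma_nb:=\mathrm{Res}_z[f_n(z;\gamma)a(z)b]dz$, $f_n=\gamma^ne^{\gamma z}/(e^{\gamma z}-1)^n$ ($f_n=z^{-n}$ if $\gamma=0$), $\widetilde O_\gamma(V)$ is the $\mathbb C[\gamma]$-span of all $a\bullet^\gamma_2b$ ($a,b\in V$) and $\widetilde A_\gamma(V)=V[\gamma]/\widetilde O_\gamma(V)$ with product $[a]\bullet^\gamma[b]=[a\bullet^\gamma_1b]$ and unit $[\mathbf 1]$. *)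

(* Defs.v *)
From HB Require Import structures.
From mathcomp Require Import all_boot all_order all_algebra.
From mathcomp Require Import generic_quotient ring_quotient.
From mathcomp Require Import boolp classical_sets functions fsbigop.
From mathcomp Require Import reals.
From mathcomp Require Import complex.

Set Implicit Arguments.
Unset Strict Implicit.
Unset Printing Implicit Defensive.

Import Order.TTheory GRing.Theory Num.Theory.

Local Open Scope ring_scope.
Local Open Scope classical_set_scope.
Local Open Scope quotient_scope.

Record pseries (A : Type) := PSeries { pscoef :> nat -> A }.
HB.instance Definition _ (A : Type) := [isNew for @pscoef A].
HB.instance Definition _ (A : choiceType) := [Choice of pseries A by <:].

Section PowerSeries.
Variable A : comNzRingType.
Implicit Types f g h : pseries A.

Lemma ps_ext f g : (forall n, f n = g n) -> f = g.
Proof. by case: f g => [f] [g] /= /funext ->. Qed.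

Definition ps_zero : pseries A := PSeries (fun=> 0).
Definition ps_opp f : pseries A := PSeries (fun n => - f n).
Definition ps_add f g : pseries A := PSeries (fun n => f n + g n).
Definition ps_one : pseries A := PSeries (fun n => (n == 0%N)%:R).
Definition ps_mul f g : pseries A :=
  PSeries (fun n => \sum_(i < n.+1) f i * g (n - i)%N).

Fact ps_addA : associative ps_add.
Proof. by move=> f g h; apply: ps_ext => n /=; rewrite addrA. Qed.
Fact ps_addC : commutative ps_add.
Proof. by move=> f g; apply: ps_ext => n /=; rewrite addrC. Qed.
Fact ps_add0 : left_id ps_zero ps_add.
Proof. by move=> f; apply: ps_ext => n /=; rewrite add0r. Qed.
Fact ps_addN : left_inverse ps_zero ps_opp ps_add.
Proof. by move=> f; apply: ps_ext => n /=; rewrite addNr. Qed.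

HB.instance Definition _ := GRing.isZmodule.Build (pseries A)
  ps_addA ps_addC ps_add0 ps_addN.

Let trunc n f : {poly A} := \poly_(i < n) f i.

Let ps_mulE n f g i : (i < n)%N -> ps_mul f g i = (trunc n f * trunc n g)`_i.
Proof.
move=> lt_in; rewrite coefM; apply: eq_bigr => -[j /= ltj] _.
rewrite !coef_poly (leq_trans ltj lt_in).
by rewrite (leq_ltn_trans (leq_subr _ _) lt_in).
Qed.

Let ps_mul3 f g h n : ps_mul (ps_mul f g) h n =
  (trunc n.+1 f * trunc n.+1 g * trunc n.+1 h)`_n.
Proof.
rewrite (@ps_mulE n.+1) // !coefM; apply: eq_bigr => -[j /= ltj] _.
by rewrite {1}/trunc coef_poly ltj (@ps_mulE n.+1).
Qed.

Fact ps_mulC : commutative ps_mul.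
Proof. by move=> f g; apply: ps_ext => n; rewrite !(@ps_mulE n.+1) // mulrC. Qed.

Fact ps_mulA : associative ps_mul.
Proof.
move=> f g h; apply: ps_ext => n; rewrite ps_mulC !ps_mul3.
by rewrite [_ * trunc _ f]mulrC mulrA.
Qed.

Fact ps_mul1 : left_id ps_one ps_mul.
Proof.
move=> f; apply: ps_ext => n /=; rewrite big_ord_recl /= mul1r subn0.
by rewrite big1 ?addr0 // => i _; rewrite mul0r.
Qed.

Fact ps_mulDl : left_distributive ps_mul +%R.
Proof.
move=> f g h; apply: ps_ext => n /=.
by rewrite -big_split; apply: eq_bigr => i _; rewrite /= mulrDl.
Qed.

Fact ps_one_neq0 : ps_one != 0.
Proof.
by apply/eqP => /(congr1 (fun f : pseries A => f 0%N)) /eqP; rewrite oner_eq0.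
Qed.

HB.instance Definition _ := GRing.Zmodule_isComNzRing.Build (pseries A)
  ps_mulA ps_mulC ps_mul1 ps_mulDl ps_one_neq0.

(* The inverse sum_m (1 - f)^m of a power series f with constant term 1; the
   m-th summand contributes nothing below degree m. *)
Definition ps_inv f : pseries A :=
  PSeries (fun n => \sum_(m < n.+1) (((1 - f) ^+ m : pseries A) n)).

Let ps_pow_small f m n : f 0%N = 0 -> (n < m)%N -> (f ^+ m : pseries A) n = 0.
Proof.
move=> f0; elim: m n => // m IHm n lt_nm; rewrite exprS /= big1 // => -[i /= lti] _.
case: i lti => [|i] lti; first by rewrite f0 mul0r.
rewrite IHm ?mulr0 //; case: n lti lt_nm => // n lti; rewrite ltnS => le_nm.
by rewrite subSS (leq_ltn_trans (leq_subr _ _)).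
Qed.

Lemma ps_coefD f g n : (f + g) n = f n + g n. Proof. by []. Qed.
Lemma ps_coefN f n : (- f) n = - f n. Proof. by []. Qed.
Lemma ps_coef1 n : (1 : pseries A) n = (n == 0%N)%:R. Proof. by []. Qed.
Lemma ps_coefM f g n : (f * g) n = \sum_(i < n.+1) f i * g (n - i)%N.
Proof. by []. Qed.
Lemma ps_coef_sum I r (P : pred I) (F : I -> pseries A) n :
  (\sum_(i <- r | P i) F i) n = \sum_(i <- r | P i) F i n.
Proof. exact: (big_morph (fun f : pseries A => f n) (fun _ _ => erefl) erefl). Qed.

Lemma ps_mulV f : f 0%N = 1 -> f * ps_inv f = 1.
Proof.
move=> f0; pose g := 1 - f; have g0 : g 0%N = 0.
  by rewrite /g ps_coefD ps_coefN f0 ps_coef1 subrr.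
apply: ps_ext => n; transitivity ((f * \sum_(m < n.+1) g ^+ m) n).
  rewrite !ps_coefM; apply: eq_bigr => -[i /= lti] _; congr (_ * _).
  rewrite ps_coef_sum /ps_inv /= -/g.
  rewrite (big_ord_widen n.+1 (fun m => (g ^+ m : pseries A) (n - i)%N)) ?ltnS ?leq_subr //.
  rewrite big_mkcond; apply: eq_bigr => m _; case: ifPn => //.
  by rewrite -leqNgt => lem; rewrite ps_pow_small.
have -> : f = 1 - g by rewrite /g opprB addrC subrK.
rewrite -[1 - g]opprB mulNr -subrX1 opprB ps_coefD ps_coefN.
by rewrite ps_pow_small // oppr0 addr0.
Qed.

End PowerSeries.

Section Kernel.
Variables (A : comUnitRingType) (g : A).

(* e^(γz) and (e^(γz) - 1) / (γz) *)
Definition ps_exp : pseries A := PSeries (fun k => g ^+ k / k`!%:R).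
Definition ps_expquo : pseries A := PSeries (fun k => g ^+ k / k.+1`!%:R).

(* z^n f_n(z; γ), where f_n = γ^n e^(γz) / (e^(γz) - 1)^n is rewritten as
   z^-n e^(γz) ((e^(γz) - 1) / (γz))^-n. This form makes sense for every γ; it
   agrees with the quotient by [kernel_numE], and gives f_n = z^-n when γ = 0
   by [kernel0]. *)
Definition kernel_num (n : nat) : pseries A := ps_exp * ps_inv ps_expquo ^+ n.

Definition kernel (n : nat) (i : int) : A :=
  if (i + n)%R is Posz k then kernel_num n k else 0.

Definition ps_z : pseries A := PSeries (fun k => (k == 1%N)%:R).
Definition ps_const (c : A) : pseries A := PSeries (fun k => if k == 0%N then c else 0).

Lemma ps_expquoE : ps_exp - 1 = ps_const g * ps_z * ps_expquo.
Proof.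
have cE c (f : pseries A) n : (ps_const c * f) n = c * f n.
  by rewrite ps_coefM big_ord_recl /= subn0 big1 ?addr0 // => i _; rewrite mul0r.
have zE (f : pseries A) n : (ps_z * f) n = if n is n'.+1 then f n' else 0.
  rewrite ps_coefM; case: n => [|n]; first by rewrite big_ord1 /= mul0r.
  rewrite big_ord_recl /= mul0r add0r big_ord_recl /= mul1r subSS subn0.
  by rewrite big1 ?addr0 // => i _; rewrite mul0r.
apply: ps_ext => n; rewrite -mulrA cE zE ps_coefD ps_coefN ps_coef1.
case: n => [|n] /=; first by rewrite expr0 divr1 subrr mulr0.
by rewrite subr0 exprS mulrA.
Qed.

Lemma kernel_numE n :
  (ps_exp - 1) ^+ n * kernel_num n = (ps_const g * ps_z) ^+ n * ps_exp.
Proof.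
rewrite ps_expquoE /kernel_num exprMn mulrCA -mulrA -exprMn ps_mulV.
  by rewrite expr1n mulr1 mulrC.
by rewrite /= expr0 divr1.
Qed.

End Kernel.

Lemma kernel0 (A : comUnitRingType) n i :
  kernel (0 : A) n i = (i == - n%:Z)%:R.
Proof.
have e1 : ps_exp (0 : A) = 1.
  by apply: ps_ext => -[|k] /=; rewrite ?divr1 ?expr0 // expr0n mul0r.
have u1 : ps_expquo (0 : A) = 1.
  by apply: ps_ext => -[|k] /=; rewrite ?divr1 ?expr0 // expr0n mul0r.
have i1 : ps_inv (1 : pseries A) = 1.
  by have := @ps_mulV A 1 erefl; rewrite mul1r.
rewrite /kernel /kernel_num e1 u1 i1 expr1n mul1r -subr_eq0 opprK.
by case: (i + n)%R => [[|k]|k].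
Qed.

(* Res_z f(z) v(z) dz for f in A((z)) and v in W((z)), given by their
   coefficients; the sum has finite support. *)
Definition res_z (A : pzRingType) (W : lmodType A) (f : int -> A)
    (v : int -> W) : W :=
  \sum_(i \in [set: int]) f i *: v (-1 - i).

Section Span.
Variables (A : pzRingType) (W : lmodType A) (S : set W).

Definition in_span : {pred W} := fun x =>
  `[< exists n (c : 'I_n -> A) (s : 'I_n -> W),
        (forall i, S (s i)) /\ x = \sum_i c i *: s i >].

Fact in_span_closed : submod_closed in_span.
Proof.
split; first by apply/asboolP; exists 0%N, (fun=> 0), (fun=> 0); split=> [[]|] //; rewrite big_ord0.
move=> a x y /asboolP[n [c [s [Ss ->]]]] /asboolP[m [d [t [St ->]]]].
apply/asboolP; exists (n + m)%N.
exists (fun i => match fintype.split i with inl i => a * c i | inr j => d j end).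
exists (fun i => match fintype.split i with inl i => s i | inr j => t j end).
split=> [i|]; first by case: (fintype.split i).
rewrite big_split_ord scaler_sumr; congr (_ + _); apply: eq_bigr => i _.
  by case: fintype.split_ordP => j /eqP; rewrite ?eq_lshift ?eq_lrshift // => /eqP <-; rewrite scalerA.
by case: fintype.split_ordP => j /eqP; rewrite ?eq_rshift ?eq_rlshift // => /eqP <-.
Qed.

HB.instance Definition _ := GRing.isSubmodClosed.Build A W in_span in_span_closed.

Definition lspan : submodClosed W := in_span.

Definition quot_span := Quotient.quot lspan.
HB.instance Definition _ := GRing.Zmodule.on quot_span.
HB.instance Definition _ := EqQuotient.on quot_span.

Definition cls (x : W) : quot_span := \pi_quot_span x.

Lemma eq_cls x y : (cls x = cls y) <-> (x - y \in lspan).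
Proof.
rewrite (Quotient.idealrBE lspan); split=> [e|/eqP//]; first exact/eqP.
Qed.

Lemma clsP (x : quot_span) : exists y, x = cls y.
Proof. by exists (repr x); rewrite /cls reprK. Qed.

Lemma clsD x y : cls (x + y) = cls x + cls y.
Proof. by rewrite /cls raddfD. Qed.

Definition quot_scale (a : A) (x : quot_span) : quot_span := cls (a *: repr x).

Lemma clsZ a x : cls (a *: x) = quot_scale a (cls x).
Proof.
apply/eq_cls; rewrite -scalerBr rpredZ //; apply/eq_cls.
by rewrite /cls reprK.
Qed.

Fact quot_scaleA a b x : quot_scale a (quot_scale b x) = quot_scale (a * b) x.
Proof. by have [y ->] := clsP x; rewrite -!clsZ scalerA. Qed.
Fact quot_scale1 : left_id 1 quot_scale.
Proof. by move=> x; have [y ->] := clsP x; rewrite -!clsZ scale1r. Qed.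
Fact quot_scaleDr : right_distributive quot_scale +%R.
Proof.
move=> a x y; have [x' ->] := clsP x; have [y' ->] := clsP y.
by rewrite -clsD -!clsZ -clsD scalerDr.
Qed.
Fact quot_scaleDl x : {morph quot_scale^~ x : a b / a + b}.
Proof. by move=> a b; have [y ->] := clsP x; rewrite -!clsZ -clsD scalerDl. Qed.

HB.instance Definition _ := GRing.Zmodule_isLmodule.Build A quot_span
  quot_scaleA quot_scale1 quot_scaleDr quot_scaleDl.

Fact cls_linear : linear cls.
Proof. by move=> a x y; rewrite clsD clsZ. Qed.
HB.instance Definition _ := GRing.isLinear.Build A W quot_span _ cls cls_linear.

End Span.

(* V[γ] = V ⊗ K[γ], as finitely supported sequences of coefficients *)
Section VectorPolynomials.
Variables (K : comNzRingType) (V : lmodType K).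

Definition finsupp_seq : {pred nat -> V} := fun f =>
  `[< exists n, forall i, (n <= i)%N -> f i = 0 >].

Record vpoly := VPoly { vcoef :> nat -> V; _ : vcoef \in finsupp_seq }.

HB.instance Definition _ := [isSub for vcoef].
HB.instance Definition _ := [Choice of vpoly by <:].

Fact finsupp_seq_closed : zmod_closed finsupp_seq.
Proof.
split; first by apply/asboolP; exists 0%N.
move=> f g /asboolP[n fP] /asboolP[m gP]; apply/asboolP; exists (n + m)%N => i le_i.
rewrite [LHS](_ : _ = f i - g i) // fP ?gP; first exact: subr0.
- exact: leq_trans (leq_addl _ _) le_i.
- exact: leq_trans (leq_addr _ _) le_i.
Qed.
HB.instance Definition _ := GRing.isZmodClosed.Build _ finsupp_seq finsupp_seq_closed.
HB.instance Definition _ := [SubChoice_isSubZmodule of vpoly by <:].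

Lemma vpoly_ext (f g : vpoly) : (forall n, f n = g n) -> f = g.
Proof. by move=> fg; apply/val_inj/funext. Qed.

Definition vpoly_scale_coef (p : {poly K}) (v : vpoly) (n : nat) : V :=
  \sum_(i < n.+1) p`_i *: v (n - i)%N.

Fact vpoly_scale_finsupp p v : vpoly_scale_coef p v \in finsupp_seq.
Proof.
case: v => v vP; have /asboolP[m v0] := vP; apply/asboolP.
exists (size p + m)%N => n le_n; apply: big1 => i _ /=.
have [/(nth_default 0)->|lt_i] := leqP (size p) i; first exact: scale0r.
have le_in : (i <= n)%N by rewrite -ltnS.
rewrite v0 ?scaler0 // leq_subRL // (leq_trans _ le_n) //.
by rewrite leq_add2r ltnW.
Qed.
Definition vpoly_scale p v : vpoly := VPoly (vpoly_scale_finsupp p v).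

Lemma vcoefD (v w : vpoly) n : (v + w) n = v n + w n.
Proof. by []. Qed.

Fact vpoly_scaleA p q v : vpoly_scale p (vpoly_scale q v) = vpoly_scale (p * q) v.
Proof.
apply: vpoly_ext => n; rewrite /= /vpoly_scale_coef /=.
pose F i j := (p`_i * q`_(j - i)) *: v (n - j)%N.
transitivity (\sum_(0 <= i < n.+1) \sum_(0 <= j < n.+1 | (i <= j)%N) F i j).
  rewrite big_mkord; apply: eq_bigr => -[i /= lti] _.
  rewrite -(@big_nat_widenl _ _ _ i 0 n.+1 xpredT (F i)) //.
  rewrite -[X in index_iota X _]add0n big_addn subSn // big_mkord scaler_sumr.
  by apply: eq_bigr => j _; rewrite /F addnK scalerA addnC subnDA.
rewrite (exchange_big_dep_nat predT) //= big_mkord.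
apply: eq_bigr => -[j /= ltj] _.
rewrite coefM scaler_suml -(big_mkord xpredT (fun i => F i j)).
by rewrite (big_nat_widen 0 j.+1 n.+1) //.
Qed.
Fact vpoly_scale1 : left_id 1 vpoly_scale.
Proof.
move=> v; apply: vpoly_ext => n; rewrite /= /vpoly_scale_coef big_ord_recl /=.
by rewrite coef1 subn0 scale1r big1 ?addr0 // => i _; rewrite coef1 scale0r.
Qed.
Fact vpoly_scaleDr : right_distributive vpoly_scale +%R.
Proof.
move=> p v w; apply: vpoly_ext => n; rewrite vcoefD /= /vpoly_scale_coef.
by rewrite -big_split; apply: eq_bigr => i _; rewrite vcoefD scalerDr.
Qed.
Fact vpoly_scaleDl v : {morph vpoly_scale^~ v : p q / p + q}.
Proof.
move=> p q; apply: vpoly_ext => n; rewrite vcoefD /= /vpoly_scale_coef.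
by rewrite -big_split; apply: eq_bigr => i _; rewrite coefD scalerDl.
Qed.

HB.instance Definition _ := GRing.Zmodule_isLmodule.Build {poly K} vpoly
  vpoly_scaleA vpoly_scale1 vpoly_scaleDr vpoly_scaleDl.

Fact vconst_finsupp (v : V) :
  (fun n => if n == 0%N then v else 0) \in finsupp_seq.
Proof. by apply/asboolP; exists 1%N => -[]. Qed.
Definition vconst (v : V) : vpoly := VPoly (vconst_finsupp v).

End VectorPolynomials.

Definition is_grading (A : pzRingType) (W : lmodType A) (hom : bool -> set W) :=
  [/\ forall p, hom p 0,
      forall p (c : A) u v, hom p u -> hom p v -> hom p (c *: u + v),
      forall v, exists v0 v1, [/\ hom false v0, hom true v1 & v = v0 + v1]
    & forall v, hom false v -> hom true v -> v = 0].

(* [hom p] is the set of vectors of parity p; true stands for odd *)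
Record superspace (K : pzRingType) := Superspace {
  ss_sort :> lmodType K;
  hom : bool -> set ss_sort;
  _ : is_grading hom }.
Arguments hom {K s}.

(* The zero algebra is allowed (Zhu algebras may vanish), unlike in algType. *)
Record is_superalgebra (A : pzRingType) (B : lmodType A) (hom : bool -> set B)
    (mul : B -> B -> B) (one : B) : Prop := IsSuperalgebra {
  salg_grading : is_grading hom;
  salg_linearl : forall x, linear (mul x);
  salg_linearr : forall y, linear (mul^~ y);
  salg_mulA : associative mul;
  salg_mul1l : left_id one mul;
  salg_mul1r : right_id one mul;
  salg_one_even : hom false one;
  salg_mul_hom : forall p q x y, hom p x -> hom q y -> hom (p (+) q) (mul x y) }.

Record is_superalgebra_iso (A : pzRingType) (B B' : lmodType A)
    (hom : bool -> set B) (hom' : bool -> set B')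
    (mul : B -> B -> B) (mul' : B' -> B' -> B') (one : B) (one' : B')
    (f : B -> B') : Prop := IsSuperalgebraIso {
  sisoL : linear f;
  sisoM : {morph f : x y / mul x y >-> mul' x y};
  siso1 : f one = one';
  siso_bij : bijective f;
  siso_hom : forall p x, hom p x <-> hom' p (f x) }.

(* (z - w) times a formal distribution g in z^±1, w^±1; g j k is the
   coefficient of z^j w^k. *)
Definition zw_mul (W : zmodType) (g : int -> int -> W) (j k : int) : W :=
  g (j - 1) k - g j (k - 1).

(* An element of (End V)[[Z^±1]] is given by its coefficients: [F j J] is the
   coefficient of Z^(j|J), the ζ's being written to the left of the operator. *)
Definition superfield (K : pzRingType) (N : nat) (V : lmodType K) :=
  int -> {set 'I_N} -> V -> V.

Section Superfields.
Variables (K : pzRingType) (N : nat) (V : lmodType K).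
Implicit Types (F G : superfield N V) (j l : int) (J L : {set 'I_N}) (v : V).

(* ζ^k ζ^J = zeta_sign k J · ζ^(J ∪ k) for k ∉ J *)
Definition zeta_sign (k : 'I_N) J : K :=
  (-1) ^+ #|[pred i | (i \in J) && (i < k)%N]|.

Definition d_zeta (k : 'I_N) F : superfield N V := fun j J v =>
  if k \in J then 0 else zeta_sign k J *: F j (k |: J) v.

Definition zeta_mul (k : 'I_N) F : superfield N V := fun j J v =>
  if k \in J then zeta_sign k J *: F j (J :\ k) v else 0.

Definition d_z F : superfield N V := fun j J v => (j + 1)%:~R *: F (j + 1) J v.

(* [D, F] for D odd and F of parity p; the first sign comes from moving D
   across ζ^J. *)
Definition odd_scomm (D : V -> V) (p : bool) F : superfield N V := fun j J v =>
  (-1) ^+ #|J| *: D (F j J v) - (-1) ^+ p *: F j J (D v).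

(* The coefficient of Z^(j|J) W^(l|L) in [F(Z), G(W)], applied to v, for F and
   G of parities p and q. All odd variables anticommute; they are moved to the
   left, past the coefficients, and ordered as ζ^J θ^L. The coefficients
   F j J and G l L have parities p + |J| and q + |L|. *)
Definition superfield_scomm (p q : bool) F G j J l L v : V :=
  (-1) ^+ ((p + #|J|) * #|L|) *: F j J (G l L v)
  - (-1) ^+ (p * q) *:
      ((-1) ^+ ((q + #|L|) * #|J| + #|J| * #|L|) *: G l L (F j J v)).

End Superfields.

(* N_K = N SUSY vertex algebras: sva_Y a is the superfield a(Z). Creation,
   a(Z)1 = a + O(Z), says that a(Z)1 has no negative power of z and that its
   constant term is a. The axioms involving signs are stated for homogeneous
   vectors. *)
Record susy_vertex_algebra (K : pzRingType) (N : nat) := SusyVertexAlgebra {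
  sva_space :> superspace K;
  sva_Y : sva_space -> superfield N sva_space;
  sva_one : sva_space;
  sva_D : 'I_N -> sva_space -> sva_space;
  sva_Y_linearl : forall j J b, linear (fun a => sva_Y a j J b);
  sva_Y_linearr : forall a j J, linear (sva_Y a j J);
  sva_Y_even : forall p q (a b : sva_space), hom p a -> hom q b ->
    forall j (J : {set 'I_N}), hom (p (+) q (+) odd #|J|) (sva_Y a j J b);
  sva_one_neq0 : sva_one != 0;
  sva_one_even : hom false sva_one;
  sva_D_linear : forall k, linear (sva_D k);
  sva_D_odd : forall k p (a : sva_space), hom p a -> hom (~~ p) (sva_D k a);
  sva_Y_laurent : forall a b, exists M : int,
    forall j J, j < M -> sva_Y a j J b = 0;
  sva_Y_one : forall j J v,
    sva_Y sva_one j J v = if (j == 0) && (J == finset.set0) then v else 0;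
  sva_creation_reg : forall a j J, j < 0 -> sva_Y a j J sva_one = 0;
  sva_creation : forall a, sva_Y a 0 finset.set0 sva_one = a;
  sva_D_one : forall k, sva_D k sva_one = 0;
  sva_D_comm : forall k p (a : sva_space), hom p a -> forall j J v,
    odd_scomm (sva_D k) p (sva_Y a) j J v =
      d_zeta k (sva_Y a) j J v - zeta_mul k (d_z (sva_Y a)) j J v;
  sva_locality : forall p q (a b : sva_space), hom p a -> hom q b -> exists M : nat,
    forall J L v j l,
      iter M (@zw_mul _)
        (fun j l => superfield_scomm p q (sva_Y a) (sva_Y b) j J l L v) j l = 0 }.

(* a_(j|J), i.e. the coefficient of Z^(-1-j|[N]\J) *)
Definition sva_mode (K : pzRingType) N (V : susy_vertex_algebra K N) (a : V)
  (j : int) (J : {set 'I_N}) : V -> V := sva_Y a (-1 - j) (~: J).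

(* va_Y a j is the coefficient of z^j in a(z), i.e. a_(-1-j). *)
Record vertex_superalgebra (K : pzRingType) := VertexSuperalgebra {
  va_space :> superspace K;
  va_Y : va_space -> int -> va_space -> va_space;
  va_one : va_space;
  va_T : va_space -> va_space;
  va_Y_linearl : forall j b, linear (fun a => va_Y a j b);
  va_Y_linearr : forall a j, linear (va_Y a j);
  va_Y_even : forall p q (a b : va_space), hom p a -> hom q b ->
    forall j, hom (p (+) q) (va_Y a j b);
  va_one_neq0 : va_one != 0;
  va_one_even : hom false va_one;
  va_T_linear : linear va_T;
  va_T_even : forall p (a : va_space), hom p a -> hom p (va_T a);
  va_Y_laurent : forall a b, exists M : int, forall j, j < M -> va_Y a j b = 0;
  va_Y_one : forall j v, va_Y va_one j v = if j == 0 then v else 0;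
  va_creation_reg : forall a j, j < 0 -> va_Y a j va_one = 0;
  va_creation : forall a, va_Y a 0 va_one = a;
  va_T_one : va_T va_one = 0;
  va_T_comm : forall a j v,
    va_T (va_Y a j v) - va_Y a j (va_T v) = (j + 1)%:~R *: va_Y a (j + 1) v;
  va_locality : forall p q (a b : va_space), hom p a -> hom q b -> exists M : nat,
    forall v j l,
      iter M (@zw_mul _)
        (fun j l => va_Y a j (va_Y b l v)
                    - (-1) ^+ (p * q) *: va_Y b l (va_Y a j v)) j l = 0 }.

Section LinearFun.
Variables (A : pzRingType) (U W : lmodType A) (f : U -> W).
Hypothesis fL : linear f.

Lemma linfunD x y : f (x + y) = f x + f y.
Proof. by have := fL 1 x y; rewrite !scale1r. Qed.

Lemma linfun0 : f 0 = 0.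
Proof. by apply: (addrI (f 0)); rewrite -linfunD !addr0. Qed.

Lemma linfunZ c x : f (c *: x) = c *: f x.
Proof. by have := fL c x 0; rewrite linfun0 !addr0. Qed.

End LinearFun.

Section Reduced.
Variables (K : comNzRingType) (N : nat) (V : susy_vertex_algebra K N).
Implicit Types (a b v : V) (k : 'I_N).

Let Y a j v : V := sva_Y a j finset.set0 v.
Let T k v : V := sva_D k (sva_D k v).

Fact reduced_even p q a b : hom p a -> hom q b ->
  forall j, hom (p (+) q) (Y a j b).
Proof. by move=> ha hb j; have := sva_Y_even ha hb j finset.set0; rewrite cards0 addbF. Qed.

Fact reduced_T_linear k : linear (T k).
Proof. by move=> c u v; rewrite /T !sva_D_linear. Qed.

Fact reduced_T_even k p a : hom p a -> hom p (T k a).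
Proof. by move=> /(sva_D_odd k)/(sva_D_odd k); rewrite negbK. Qed.

Fact reduced_laurent a b : exists M : int, forall j, j < M -> Y a j b = 0.
Proof. by have [M YM] := sva_Y_laurent a b; exists M => j ltj; exact: YM. Qed.

Fact reduced_one j v : Y (sva_one V) j v = if j == 0 then v else 0.
Proof. by rewrite /Y sva_Y_one eqxx andbT. Qed.

Fact reduced_T_one k : T k (sva_one V) = 0.
Proof.
by rewrite /T sva_D_one (linfun0 (sva_D_linear k)).
Qed.

Fact reduced_T_comm k a j v :
  T k (Y a j v) - Y a j (T k v) = (j + 1)%:~R *: Y a (j + 1) v.
Proof.
have DA := linfunD (@sva_D_linear _ _ V k); have DZ := linfunZ (@sva_D_linear _ _ V k).
have homP p u : hom p u -> T k (Y u j v) - Y u j (T k v) = (j + 1)%:~R *: Y u (j + 1) v.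
  move=> hu.
  have D0 w : sva_D k (Y u j w) = (-1) ^+ p *: Y u j (sva_D k w) + sva_Y u j [set k]%SET w.
    have := sva_D_comm k hu j finset.set0 w.
    rewrite /odd_scomm /d_zeta /zeta_mul !inE cards0 expr0 scale1r finset.setU0 subr0.
    rewrite /zeta_sign eq_card0 ?expr0 ?scale1r => [|i]; last by rewrite !inE.
    by move/eqP; rewrite subr_eq addrC => /eqP.
  have D1 w : sva_D k (sva_Y u j [set k]%SET w) =
      (j + 1)%:~R *: Y u (j + 1) w - (-1) ^+ p *: sva_Y u j [set k]%SET (sva_D k w).
    have := sva_D_comm k hu j [set k]%SET w.
    rewrite /odd_scomm /d_zeta /zeta_mul /d_z !inE eqxx cards1 expr1 sub0r finset.setDv.
    rewrite /zeta_sign eq_card0 ?expr0 ?scale1r => [|i]; last first.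
      by rewrite !inE; case: eqP => //= ->; rewrite ltnn.
    by move/eqP; rewrite scaleN1r -opprD eqr_opp eq_sym -subr_eq => /eqP ->.
  rewrite /T D0 DA DZ D0 D1 scalerDr scalerA -expr2 sqrr_sign scale1r.
  by rewrite -(addrA (Y _ _ _)) [Y _ _ _ + _]addrC addrK addrC subrK.
have [_ _ /(_ a)[a0 [a1 [h0 h1 ea]]] _] : is_grading (@hom _ V) by case: (sva_space V).
have YA i x : Y (a0 + a1) i x = Y a0 i x + Y a1 i x.
  exact: (linfunD (sva_Y_linearl _ _ _)).
rewrite ea !YA scalerDr -(homP _ _ h0) -(homP _ _ h1) /T !DA.
by rewrite opprD addrACA.
Qed.

Lemma sva_D2E k a : sva_D k (sva_D k a) = sva_mode a (-2%:Z) [set: 'I_N]%SET (sva_one V).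
Proof.
have := reduced_T_comm k a 0 (sva_one V).
rewrite reduced_T_one /T /Y sva_creation /sva_mode add0r scale1r finset.setCT.
by rewrite (linfun0 (sva_Y_linearr _ _ _)) subr0 => ->.
Qed.

Lemma sva_D2_indep k l a : sva_D k (sva_D k a) = sva_D l (sva_D l a).
Proof. by rewrite !sva_D2E. Qed.

Fact reduced_locality p q a b : hom p a -> hom q b -> exists M : nat,
  forall v j l, iter M (@zw_mul _)
    (fun j l => Y a j (Y b l v) - (-1) ^+ (p * q) *: Y b l (Y a j v)) j l = 0.
Proof.
move=> ha hb; have [M loc] := sva_locality ha hb; exists M => v j l.
rewrite -[RHS](loc finset.set0 finset.set0 v j l); congr (iter M _ _ j l).
apply/funext => i; apply/funext => m.
by rewrite /superfield_scomm cards0 !muln0 !expr0 !scale1r.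
Qed.

Hypothesis N_gt0 : (0 < N)%N.

(* By sva_D2_indep, the choice of the index of D is irrelevant. *)
Definition reduced : vertex_superalgebra K :=
  @VertexSuperalgebra K V Y (sva_one V) (T (Ordinal N_gt0))
    (fun j => sva_Y_linearl j finset.set0) (fun a j => sva_Y_linearr a j finset.set0)
    reduced_even (sva_one_neq0 V) (sva_one_even V)
    (@reduced_T_linear _) (@reduced_T_even _) reduced_laurent
    reduced_one (fun a j => @sva_creation_reg _ _ V a j finset.set0)
    (@sva_creation _ _ V) (reduced_T_one _) (@reduced_T_comm _) reduced_locality.

End Reduced.

(* γ is either a number, and then C[γ] and V[γ] mean C and V, or a formal
   variable. *)
Inductive gamma_param (K : Type) := GammaNumber of K | GammaFormal.
Arguments GammaFormal {K}.

Section Gamma.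
Variable K : fieldType.

Definition gamma_ring (γ : gamma_param K) : comUnitRingType :=
  match γ with GammaNumber _ => K | GammaFormal => {poly K} end.

Definition gamma_val (γ : gamma_param K) : gamma_ring γ :=
  match γ return gamma_ring γ with GammaNumber c => c | GammaFormal => 'X end.

Variable V : lmodType K.

Definition gamma_mod (γ : gamma_param K) : lmodType (gamma_ring γ) :=
  match γ return lmodType (gamma_ring γ) with
  | GammaNumber _ => V
  | GammaFormal => vpoly V
  end.

Definition gamma_in (γ : gamma_param K) : V -> gamma_mod γ :=
  match γ return V -> gamma_mod γ with
  | GammaNumber _ => id
  | GammaFormal => @vconst K V
  end.

(* Res_z f_n(z; γ) v(z) dz for v in V((z)) *)
Definition gamma_res (γ : gamma_param K) (n : nat) (v : int -> V) : gamma_mod γ :=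
  res_z (kernel (gamma_val γ) n) (fun j => gamma_in γ (v j)).

End Gamma.

(* The parity-p part of the quotient of V[γ] by the span of S, spanned by the
   classes of the parity-p vectors of V *)
Definition quot_hom (K : fieldType) (V : superspace K) (γ : gamma_param K)
    (S : set (gamma_mod V γ)) (p : bool) : set (quot_span S) :=
  [set x | x \in lspan [set y | exists2 v : V, hom p v & y = cls S (gamma_in γ v)]].

Section SusyZhu.
Variables (K : fieldType) (N : nat) (V : susy_vertex_algebra K N).
Variable γ : gamma_param K.

Definition sva_bullet (n : nat) (a b : V) : gamma_mod V γ :=
  gamma_res γ n (fun j => sva_Y a j finset.set0 b).

Definition sva_zhu_gens : set (gamma_mod V γ) :=
  [set x | exists (n : nat) (a b : V), (2 <= n)%N /\ x = sva_bullet n a b].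

Definition sva_zhu : lmodType (gamma_ring γ) := quot_span sva_zhu_gens.
Definition sva_zhu_cls (x : gamma_mod V γ) : sva_zhu := cls sva_zhu_gens x.
Definition sva_zhu_hom : bool -> set sva_zhu := @quot_hom K V γ sva_zhu_gens.

(* A bilinear product is determined by this property, since the classes of
   the vectors of V span the quotient. *)
Definition is_sva_zhu_product (mul : sva_zhu -> sva_zhu -> sva_zhu) : Prop :=
  forall a b : V,
    mul (sva_zhu_cls (gamma_in γ a)) (sva_zhu_cls (gamma_in γ b)) =
      sva_zhu_cls (sva_bullet 1 a b).

Definition sva_zhu_one : sva_zhu := sva_zhu_cls (gamma_in γ (sva_one V)).

End SusyZhu.

Section Zhu.
Variables (K : fieldType) (V : vertex_superalgebra K).
Variable γ : gamma_param K.

Definition va_bullet (n : nat) (a b : V) : gamma_mod V γ :=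
  gamma_res γ n (fun j => va_Y a j b).

Definition va_zhu_gens : set (gamma_mod V γ) :=
  [set x | exists a b : V, x = va_bullet 2 a b].

Definition va_zhu : lmodType (gamma_ring γ) := quot_span va_zhu_gens.
Definition va_zhu_cls (x : gamma_mod V γ) : va_zhu := cls va_zhu_gens x.
Definition va_zhu_hom : bool -> set va_zhu := @quot_hom K V γ va_zhu_gens.

Definition is_va_zhu_product (mul : va_zhu -> va_zhu -> va_zhu) : Prop :=
  forall a b : V,
    mul (va_zhu_cls (gamma_in γ a)) (va_zhu_cls (gamma_in γ b)) =
      va_zhu_cls (va_bullet 1 a b).

Definition va_zhu_one : va_zhu := va_zhu_cls (gamma_in γ (va_one V)).

End Zhu.

Lemma sva_bullet0 (K : fieldType) N (V : susy_vertex_algebra K N) n (a b : V) :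
  sva_bullet (GammaNumber 0) n a b = sva_mode a (- n%:Z) [set: 'I_N]%SET b.
Proof.
rewrite /sva_bullet /gamma_res /res_z /sva_mode finset.setCT.
rewrite -(@fsbig_widen _ _ _ _ [set - n%:Z]) ?fsbig_set1 //=.
  by rewrite kernel0 eqxx scale1r.
by move=> i [_ /= /eqP ni]; rewrite kernel0 (negPf ni) scale0r.
Qed.

(* Main.v *)
Require Import Defs.
From mathcomp Require Import all_boot all_order all_algebra.
From mathcomp Require Import boolp classical_sets functions fsbigop.
From mathcomp Require Import reals complex.
From mathcomp Require Import zify ring.

(* Odd variables play no role: •_n only involves the fields a(z, 0, ..., 0), so
   both algebras are quotients of V[γ] and it suffices to see that the span of
   the a •_n b with n >= 2 is the span of the a •_2 b, and to treat a vertex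
   superalgebra.

   In the coordinate u = (e^(γz) - 1)/γ the form γ^n e^(γz)/(e^(γz) - 1)^n dz
   becomes u^(-n) du, so a •_n b is the (-n)-th mode of a, applied to b, of the
   fields written in u. These fields satisfy the axioms of a vertex
   superalgebra with scalars C[γ], except that translation acts as
   (1 + γu) d/du. Goddard's uniqueness theorem and Dong's lemma therefore apply
   and give
     (Ta)_(n) = - n a_(n-1) - γ (n+1) a_(n),
     (a_(-1) b)_(n) = sum_(i >= 0) a_(-1-i) b_(n+i) ± b_(n-1-i) a_(i).
   Let O be the span of the a_(-2) b. The first formula puts every a_(-n) b with
   n >= 2 in O, and the second one then gives, modulo O,
     (a_(-1) b)_(-n) c = a_(-1) (b_(-n) c)    for n = 1, 2.
   The case n = 1 is associativity and the case n = 2 shows that O is a left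
   ideal; it is a right ideal because a_(-2) b = (Ta)_(-1) b. *)

Set Implicit Arguments.
Unset Strict Implicit.
Unset Printing Implicit Defensive.

Import Order.TTheory GRing.Theory Num.Theory.

Local Open Scope ring_scope.

(** * Identities for signs and scalars *)

Lemma subrACA (W : zmodType) (a b c d : W) : a - b - (c - d) = a - c - (b - d).
Proof. by rewrite !opprB addrACA [RHS]addrACA [- b + _]addrC. Qed.

Lemma sign_addb_mul (A : pzRingType) (p q r : bool) :
  (-1) ^+ ((p (+) q) * r) = (-1) ^+ (p * r) * (-1) ^+ (q * r) :> A.
Proof. by rewrite exprM signr_addb; case: r; rewrite ?muln1 ?muln0 ?mulr1. Qed.

Lemma scale_linear (A : comPzRingType) (W : lmodType A) (c : A) :
  linear (fun w : W => c *: w).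
Proof. by move=> d u v; rewrite scalerDr !scalerA mulrC. Qed.

Lemma unit_scalerI (A : unitRingType) (W : lmodType A) (c : A) :
  c \is a GRing.unit -> injective ( *:%R c : W -> W).
Proof.
by move=> cU x y /(congr1 ( *:%R c^-1)); rewrite !scalerA mulVr // !scale1r.
Qed.

(** * Sums over the natural numbers with finite support *)

Section FiniteSums.
Variable W : zmodType.
Implicit Types g h : nat -> W.

Definition ultimately0 g := exists B : nat, forall i, (B <= i)%N -> g i = 0.

(** A total operation with default value 0 for infinite support, so that modes and residues can be
    written down before finiteness is known. [ultimately0] supplies finiteness where a computation
    needs it. *)
Definition nsum g : W := \sum_(i \in [set: nat]) g i.

Lemma nsumE B g : (forall i, (B <= i)%N -> g i = 0) -> nsum g = \sum_(i < B) g i.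
Proof.
move=> g0; rewrite -(big_mkord xpredT) (@bigfs _ _ _ _ _ predT) ?iota_uniq //.
  by apply: eq_fsbigl; apply/seteqP; split.
by move=> i _; rewrite mem_index_iota /= -leqNgt => /g0.
Qed.

Lemma eq_nsum g h : g =1 h -> nsum g = nsum h.
Proof. by move=> /funext ->. Qed.

Lemma nsum0 g : (forall i, g i = 0) -> nsum g = 0.
Proof. by move=> g0; rewrite (@nsumE 0) ?big_ord0. Qed.

Lemma ultimately0_2 g h : ultimately0 g -> ultimately0 h ->
  exists B, forall i, (B <= i)%N -> g i = 0 /\ h i = 0.
Proof.
move=> [B g0] [C h0]; exists (maxn B C) => i; rewrite geq_max => /andP[Bi Ci].
by rewrite g0 ?h0.
Qed.

Lemma nsumD g h : ultimately0 g -> ultimately0 h ->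
  nsum (fun i => g i + h i) = nsum g + nsum h.
Proof.
move=> /ultimately0_2/[apply]-[B gh0].
by rewrite !(@nsumE B) ?big_split // => i /gh0[gi hi]; rewrite ?gi ?hi ?addr0.
Qed.

Lemma nsumN g : ultimately0 g -> nsum (fun i => - g i) = - nsum g.
Proof.
by move=> [B g0]; rewrite !(@nsumE B) ?sumrN // => i /g0 ->; rewrite oppr0.
Qed.

Lemma nsumB g h : ultimately0 g -> ultimately0 h ->
  nsum (fun i => g i - h i) = nsum g - nsum h.
Proof.
move=> /ultimately0_2/[apply]-[B gh0].
by rewrite !(@nsumE B) ?sumrB // => i /gh0[gi hi]; rewrite ?gi ?hi ?subr0.
Qed.

Lemma nsum_recl g : ultimately0 g -> nsum g = g 0%N + nsum (fun i => g i.+1).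
Proof.
move=> [B g0]; rewrite (@nsumE B.+1) ?big_ord_recl; last by move=> i /ltnW/g0.
by rewrite (@nsumE B) // => i ?; apply: g0; apply: leqW.
Qed.

Lemma nsum_telescope g : ultimately0 g -> nsum (fun i => g i - g i.+1) = g 0%N.
Proof.
move=> g0; rewrite nsumB //; first by rewrite nsum_recl // addrK.
by have [B gB] := g0; exists B => i ?; apply: gB; apply: leqW.
Qed.

Lemma nsum_closed (P : W -> Prop) g : P 0 -> (forall x y, P x -> P y -> P (x + y)) ->
  (forall i, P (g i)) -> ultimately0 g -> P (nsum g).
Proof. by move=> P0 PD Pg [B g0]; rewrite (nsumE g0); apply: (big_ind P). Qed.

End FiniteSums.

Lemma linfunN (A : pzRingType) (W W' : lmodType A) (f : W -> W') x :
  linear f -> f (- x) = - f x.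
Proof. by move=> fL; rewrite -scaleN1r (linfunZ fL) scaleN1r. Qed.

Lemma linfunB (A : pzRingType) (W W' : lmodType A) (f : W -> W') x y :
  linear f -> f (x - y) = f x - f y.
Proof. by move=> fL; rewrite (linfunD fL) linfunN. Qed.

Lemma linear_nsum (A : pzRingType) (W W' : lmodType A) (f : W -> W') (g : nat -> W) :
  linear f -> ultimately0 g -> f (nsum g) = nsum (fun i => f (g i)).
Proof.
move=> fL [B g0]; rewrite !(@nsumE _ B) //.
  exact: (big_morph f (linfunD fL) (linfun0 fL)).
by move=> i /g0 ->; rewrite (linfun0 fL).
Qed.

(* (z - w) times a formal distribution whose coefficient of z^(-1-i) w^(-1-j)
   is g i j *)
Definition mode_diff (W : zmodType) (g : int -> int -> W) : int -> int -> W :=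
  fun i j => g (i + 1) j - g i (j + 1).

(* Vertex superalgebras in modes, [mode n x y] being x_(n) y, written in a
   coordinate u in which translation acts as (1 + γu) d/du. For γ = 0 these are
   the usual axioms; for general γ they hold in u = (e^(γz) - 1)/γ. *)
Record is_mode_algebra (A : pzRingType) (W : lmodType A) (γ : A)
    (hom : bool -> W -> Prop) (mode : int -> W -> W -> W) (one : W) (T : W -> W) :
    Prop := IsModeAlgebra {
  mode_linl : forall n y, linear (fun x => mode n x y);
  mode_linr : forall n x, linear (mode n x);
  mode_trunc : forall x y, exists n0 : int, forall n, n0 <= n -> mode n x y = 0;
  mode1l : forall n y, mode n one y = if n == -1 then y else 0;
  mode1r_reg : forall n x, 0 <= n -> mode n x one = 0;
  mode1r : forall x, mode (-1) x one = x;
  transl_lin : linear T;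
  transl1 : T one = 0;
  transl_comm : forall n x y, T (mode n x y) - mode n x (T y) =
    - (n%:~R *: mode (n - 1) x y) - (γ * (n + 1)%:~R) *: mode n x y;
  mode_grading : is_grading hom;
  mode_hom : forall p q x y n, hom p x -> hom q y -> hom (p (+) q) (mode n x y);
  transl_hom : forall p x, hom p x -> hom p (T x);
  mode_local : forall p q x y, hom p x -> hom q y -> exists M : nat, forall v i j,
    iter M (@mode_diff _)
      (fun i j => mode i x (mode j y v) - (-1) ^+ (p * q) *: mode j y (mode i x v)) i j = 0
}.

(** * Powers of z - w acting on formal distributions *)

Section ModeDiff.
Variable W : zmodType.
Implicit Types g h : int -> int -> W.

Lemma iter_mode_diff0 M i j : iter M (@mode_diff W) (fun _ _ => 0) i j = 0.
Proof. by elim: M i j => //= M IH i j; rewrite /mode_diff !IH subrr. Qed.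

Lemma iter_mode_diffD M g h i j : iter M (@mode_diff W) (fun i j => g i j + h i j) i j =
  iter M (@mode_diff W) g i j + iter M (@mode_diff W) h i j.
Proof.
elim: M i j => //= M IH i j; rewrite /mode_diff !IH.
by rewrite opprD addrACA.
Qed.

Lemma iter_mode_diffN M g i j : iter M (@mode_diff W) (fun i j => - g i j) i j =
  - iter M (@mode_diff W) g i j.
Proof. by elim: M i j => //= M IH i j; rewrite /mode_diff !IH opprD. Qed.

Lemma iter_mode_diff_le M N g : (M <= N)%N ->
  (forall i j, iter M (@mode_diff W) g i j = 0) ->
  forall i j, iter N (@mode_diff W) g i j = 0.
Proof.
move=> /subnK <- g0 i j; rewrite iterD.
have -> : iter M (@mode_diff W) g = fun _ _ => 0 by apply/funext => a; apply/funext => b.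
exact: iter_mode_diff0.
Qed.

Lemma iter_mode_diff_shift M g k l i j :
  iter M (@mode_diff W) (fun i j => g (i + k) (j + l)) i j =
  iter M (@mode_diff W) g (i + k) (j + l).
Proof.
elim: M i j => //= M IH i j; rewrite /mode_diff !IH.
by rewrite [i + 1 + k]addrAC [j + 1 + l]addrAC.
Qed.

(** The distribution is regular in w, and second index -1 selects its value at w = 0. There (z -
    w)^M becomes z^M, which shifts the first index by M. *)
Lemma iter_mode_diff_regular M g i :
  (forall i j, 0 <= j -> g i j = 0) -> iter M (@mode_diff W) g i (-1) = g (i + M%:Z) (-1).
Proof.
move=> g0; elim: M g g0 i => [|M IH] g g0 i; first by rewrite addr0.
rewrite iterSr IH => [|{}i j j0]; last by rewrite /mode_diff !g0 ?subrr //; lia.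
rewrite /mode_diff [X in _ - g _ X](_ : _ = 0) // (g0 _ 0) // subr0; congr (g _ _); lia.
Qed.

End ModeDiff.

(** Additivity is the right generality because the inclusion of V into V[γ] relates modules over
    different rings. *)
Lemma additive_iter_mode_diff (W W' : zmodType) (f : W -> W') M (g : int -> int -> W) i j :
  {morph f : u v / u - v} ->
  f (iter M (@mode_diff W) g i j) = iter M (@mode_diff W') (fun i j => f (g i j)) i j.
Proof. by move=> fB; elim: M i j => //= M IH i j; rewrite /mode_diff fB !IH. Qed.

Lemma linear_iter_mode_diff (A : pzRingType) (W W' : lmodType A) (f : W -> W') M
    (g : int -> int -> W) i j : linear f ->
  f (iter M (@mode_diff W) g i j) = iter M (@mode_diff W') (fun i j => f (g i j)) i j.
Proof. by move=> fL; apply: additive_iter_mode_diff => u v; rewrite linfunB. Qed.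

(** * Dong's lemma *)

Section NormalOrder.
Variable W : zmodType.
Implicit Types g h : int -> int -> int -> W.

(** Multiplication by x - y, x - w and y - w of a distribution whose coefficient of x^(-1-i)
    y^(-1-j) w^(-1-k) is [g i j k]. *)
Definition diff12 g : int -> int -> int -> W := fun i j k => g (i + 1) j k - g i (j + 1) k.
Definition diff13 g : int -> int -> int -> W := fun i j k => g (i + 1) j k - g i j (k + 1).
Definition diff23 g : int -> int -> int -> W := fun i j k => g i (j + 1) k - g i j (k + 1).

Lemma iter_diff12 M g i j k :
  iter M diff12 g i j k = iter M (@mode_diff W) (fun i j => g i j k) i j.
Proof. by elim: M i j => //= M IH i j; rewrite /diff12 /mode_diff !IH. Qed.

Lemma iter_diff13 M g i j k :
  iter M diff13 g i j k = iter M (@mode_diff W) (fun i k => g i j k) i k.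
Proof. by elim: M i k => //= M IH i k; rewrite /diff13 /mode_diff !IH. Qed.

Lemma iter_diff23 M g i j k :
  iter M diff23 g i j k = iter M (@mode_diff W) (g i) j k.
Proof. by elim: M j k => //= M IH j k; rewrite /diff23 /mode_diff !IH. Qed.

Let diff_ext g h : (forall i j k, g i j k = h i j k) -> g = h.
Proof. by move=> gh; apply/funext => i; apply/funext => j; apply/funext => k. Qed.

Let diff12_13 g : diff12 (diff13 g) = diff13 (diff12 g).
Proof. by apply: diff_ext => i j k; rewrite /diff12 /diff13 subrACA. Qed.

Let diff12_23 g : diff12 (diff23 g) = diff23 (diff12 g).
Proof. by apply: diff_ext => i j k; rewrite /diff12 /diff23 subrACA. Qed.

Let diff13_23 g : diff13 (diff23 g) = diff23 (diff13 g).
Proof. by apply: diff_ext => i j k; rewrite /diff13 /diff23 subrACA. Qed.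

Let iter_comm (D E : (int -> int -> int -> W) -> int -> int -> int -> W) m n g :
  (forall g, D (E g) = E (D g)) -> iter m D (iter n E g) = iter n E (iter m D g).
Proof.
move=> DE; elim: m g => //= m IH g; rewrite {}IH.
by elim: n => //= n <-; rewrite DE.
Qed.

(** For fixed k the bound is uniform in the other index. This makes the sums of [res_above] finite,
    as [bounded1] does for [res_below], and it survives multiplication by the three differences. *)
Definition bounded2 g := forall k, exists J, forall i j, J <= j -> g i j k = 0.
Definition bounded1 g := forall k, exists I, forall i j, I <= i -> g i j k = 0.

Let bounded2_diff12 g : bounded2 g -> bounded2 (diff12 g).
Proof.
move=> gb k; have [J gJ] := gb k; exists J => i j leJ.
by rewrite /diff12 !gJ ?subrr //; lia.
Qed.

Let bounded1_diff12 g : bounded1 g -> bounded1 (diff12 g).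
Proof.
move=> gb k; have [I gI] := gb k; exists I => i j leI.
by rewrite /diff12 !gI ?subrr //; lia.
Qed.

Let bounded2_diff13 g : bounded2 g -> bounded2 (diff13 g).
Proof.
move=> gb k; have [J gJ] := gb k; have [J' gJ'] := gb (k + 1).
by exists (`|J| + `|J'|) => i j leJ; rewrite /diff13 gJ ?gJ' ?subrr //; lia.
Qed.

Let bounded1_diff13 g : bounded1 g -> bounded1 (diff13 g).
Proof.
move=> gb k; have [I gI] := gb k; have [I' gI'] := gb (k + 1).
by exists (`|I| + `|I'|) => i j leI; rewrite /diff13 gI ?gI' ?subrr //; lia.
Qed.

Let bounded2_diff23 g : bounded2 g -> bounded2 (diff23 g).
Proof.
move=> gb k; have [J gJ] := gb k; have [J' gJ'] := gb (k + 1).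
by exists (`|J| + `|J'|) => i j leJ; rewrite /diff23 gJ ?gJ' ?subrr //; lia.
Qed.

Let bounded1_diff23 g : bounded1 g -> bounded1 (diff23 g).
Proof.
move=> gb k; have [I gI] := gb k; have [I' gI'] := gb (k + 1).
by exists (`|I| + `|I'|) => i j leI; rewrite /diff23 gI ?gI' ?subrr //; lia.
Qed.

(* The residues in x of g / (x - y), expanded in |x| > |y| and, up to sign, in
   |y| > |x|. *)
Definition res_above g : int -> int -> W :=
  fun j k => nsum (fun n : nat => g (-1 - n%:Z) (j + n%:Z) k).
Definition res_below g : int -> int -> W :=
  fun j k => nsum (fun n : nat => g n%:Z (j - 1 - n%:Z) k).

Lemma res_above_fin g j k : bounded2 g ->
  ultimately0 (fun n : nat => g (-1 - n%:Z) (j + n%:Z) k).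
Proof.
by move=> /(_ k)[J gJ]; exists `|J - j|%N => n leJ; apply: gJ; lia.
Qed.

Lemma res_below_fin g j k : bounded1 g ->
  ultimately0 (fun n : nat => g n%:Z (j - 1 - n%:Z) k).
Proof. by move=> /(_ k)[I gI]; exists `|I|%N => n leI; apply: gI; lia. Qed.

Let res g1 g2 : int -> int -> W := fun j k => res_above g1 j k + res_below g2 j k.

(** Multiplication by x - y cancels the denominator: both sums telescope to the residue [g 0 j k],
    with opposite signs. *)
Let res_diff12 g : bounded2 g -> bounded1 g -> res (diff12 g) (diff12 g) = fun _ _ => 0.
Proof.
move=> b2 b1; apply/funext => j; apply/funext => k; rewrite /res /res_above /res_below.
pose F n := g (- n%:Z) (j + n%:Z) k; pose G (n : nat) := g n%:Z (j - n%:Z) k.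
have Ffin : ultimately0 F.
  by have [J gJ] := b2 k; exists `|J - j|%N => n leJ; apply: gJ; lia.
have Gfin : ultimately0 G.
  by have [I gI] := b1 k; exists `|I|%N => n leI; apply: gI; lia.
rewrite (@eq_nsum _ _ (fun n => F n - F n.+1)) => [|n]; last first.
  by rewrite /diff12 /F; congr (g _ _ _ - g _ _ _); lia.
rewrite (@eq_nsum _ (fun n => diff12 g _ _ _) (fun n => - (G n - G n.+1))) => [|n].
  2: by rewrite /diff12 opprB /G; congr (g _ _ _ - g _ _ _); lia.
rewrite nsum_telescope // nsumN ?nsum_telescope //; first by rewrite /F /G oppr0 !addr0 subrr.
by have [B G0] := Gfin; exists B => n len; rewrite !G0 ?subrr //; exact: leqW.
Qed.

Let res_diff23 g1 g2 : bounded2 g1 -> bounded1 g2 ->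
  mode_diff (res g1 g2) = res (diff23 g1) (diff23 g2).
Proof.
move=> b2 b1; apply/funext => j; apply/funext => k.
rewrite /mode_diff /res opprD addrACA /res_above /res_below; congr (_ + _).
  rewrite -nsumB; try exact: res_above_fin.
  by apply: eq_nsum => n; rewrite /diff23; congr (g1 _ _ _ - _); lia.
rewrite -nsumB; try exact: res_below_fin.
by apply: eq_nsum => n; rewrite /diff23; congr (g2 _ _ _ - _); lia.
Qed.

(** The factor y - w = (x - w) - (x - y) is moved under the residue in x. *)
Let res_diff13 g1 g2 : bounded2 g1 -> bounded1 g2 ->
  mode_diff (res g1 g2) =
  fun j k => res (diff13 g1) (diff13 g2) j k - res (diff12 g1) (diff12 g2) j k.
Proof.
move=> b2 b1; rewrite res_diff23 //; apply/funext => j; apply/funext => k.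
rewrite /res opprD addrACA /res_above /res_below; congr (_ + _).
  rewrite -nsumB; [|exact/res_above_fin/bounded2_diff13|exact/res_above_fin/bounded2_diff12].
  by apply: eq_nsum => n; rewrite /diff23 /diff13 /diff12 opprB [RHS]addrC subrKA.
rewrite -nsumB; [|exact/res_below_fin/bounded1_diff13|exact/res_below_fin/bounded1_diff12].
by apply: eq_nsum => n; rewrite /diff23 /diff13 /diff12 opprB [RHS]addrC subrKA.
Qed.

Let iter_diff12_0 n : iter n diff12 (fun _ _ _ => 0) = (fun _ _ _ => 0).
Proof.
by apply: diff_ext => i j k; rewrite iter_diff12 iter_mode_diff0.
Qed.

(* Induction on s + t, using y - w = (x - w) - (x - y). *)
Let dong_step n : forall s t g1 g2, (s + t = n)%N -> bounded2 g1 -> bounded1 g2 ->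
  iter s diff12 g1 = iter s diff12 g2 ->
  iter t diff13 g1 = (fun _ _ _ => 0) -> iter t diff13 g2 = (fun _ _ _ => 0) ->
  forall j k, iter n (@mode_diff W) (res g1 g2) j k = 0.
Proof.
elim: n => [|n IH] s t g1 g2 st b2 b1 e12 g10 g20 j k.
  have t0 : t = 0%N by lia.
  by move: g10 g20; rewrite t0 /= => -> ->; rewrite /res /res_above /res_below !nsum0 ?addr0.
have sub0 : forall u1 u2 : int -> int -> W,
    (forall j k, iter n (@mode_diff W) u1 j k = 0) ->
    (forall j k, iter n (@mode_diff W) u2 j k = 0) ->
    iter n (@mode_diff W) (fun j k => u1 j k - u2 j k) j k = 0.
  by move=> u1 u2 u10 u20; rewrite iter_mode_diffD iter_mode_diffN u10 u20 subrr.
rewrite iterSr res_diff13 //; apply: sub0.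
  (* The factor x - w lowers t; for t = 0 both distributions are already zero. *)
  case: t st g10 g20 => [|t] st g10 g20.
    move: g10 g20 => /= -> ->.
    have z : res (diff13 (fun _ _ _ => 0)) (diff13 (fun _ _ _ => 0)) = fun _ _ => 0.
      apply/funext => a; apply/funext => b; rewrite /res /res_above /res_below /diff13.
      by rewrite !nsum0 ?addr0 // => i; rewrite subrr.
    by move=> ? ?; rewrite z iter_mode_diff0.
  apply: (IH s t); rewrite -?iterSr //; first lia.
  - exact: bounded2_diff13.
  - exact: bounded1_diff13.
  - by rewrite !(@iter_comm diff12 diff13 s 1) // e12.
(* The factor x - y lowers s; for s = 0 the two distributions coincide and their two expansions
   cancel. *)
case: s st e12 => [|s] st e12.
  by move: e12 b1 => /= <- b1 ? ?; rewrite res_diff12 // iter_mode_diff0.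
have dt0 : diff12 (fun _ _ _ => 0) = (fun _ _ _ => 0) by exact: (iter_diff12_0 1).
apply: (IH s t); rewrite -?iterSr //; first lia.
- exact: bounded2_diff12.
- exact: bounded1_diff12.
- by rewrite -(@iter_comm diff12 diff13 1 t) //= g10.
- by rewrite -(@iter_comm diff12 diff13 1 t) //= g20.
Qed.

(** In the application [g1] and [g2] are the supercommutators of a third field with the two
    orderings of a product. The factor (y - w)^r does not involve x, so it passes under the residue;
    [dong_step] provides the remaining s + t factors. *)
Lemma dong r s t g1 g2 : bounded2 g1 -> bounded1 g2 ->
  iter s diff12 g1 = iter s diff12 g2 ->
  iter t diff13 (iter r diff23 g1) = (fun _ _ _ => 0) ->
  iter t diff13 (iter r diff23 g2) = (fun _ _ _ => 0) ->
  forall j k, iter (s + t + r) (@mode_diff W)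
    (fun j k => res_above g1 j k + res_below g2 j k) j k = 0.
Proof.
elim: r g1 g2 => [|r IH] g1 g2 b2 b1 e12 g10 g20 j k.
  by rewrite addn0; apply: (@dong_step _ s t).
rewrite addnS iterSr -/(res g1 g2) res_diff23 //; apply: IH; rewrite -?iterSr //.
- exact: bounded2_diff23.
- exact: bounded1_diff23.
- by rewrite !(@iter_comm diff12 diff23 s 1) // e12.
Qed.

(** Meant for the Leibniz rule: P contains the supercommutator of the second field with the third
    and is killed by (y - w)^r, Q contains that of the first with the third and is killed by (x -
    w)^t. The two powers commute. *)
Lemma iter_diff_split r t g P Q :
  (forall i j k, g i j k = P i j k + Q i j k) ->
  (forall i j k, iter r (@mode_diff W) (P i) j k = 0) ->
  (forall i j k, iter t (@mode_diff W) (fun i k => Q i j k) i k = 0) ->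
  iter t diff13 (iter r diff23 g) = (fun _ _ _ => 0).
Proof.
move=> gPQ P0 Q0.
have -> : iter r diff23 g = iter r diff23 Q.
  apply: diff_ext => i j k; rewrite !iter_diff23.
  have -> : g i = fun j k => P i j k + Q i j k.
    by apply/funext => b; apply/funext => c.
  by rewrite iter_mode_diffD P0 add0r.
rewrite iter_comm //.
have -> : iter t diff13 Q = fun _ _ _ => 0.
  by apply: diff_ext => i j k; rewrite iter_diff13 Q0.
by apply: diff_ext => i j k; rewrite iter_diff23 iter_mode_diff0.
Qed.

End NormalOrder.

(** * Normally ordered products *)

(** The new distribution is -(1 + γz) ∂_z g. One differentiation costs at most one more factor z -
    w. *)
Lemma iter_mode_diff_transl (A : comPzRingType) (W : lmodType A) (γ : A) M
    (g : int -> int -> W) :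
  (forall i j, iter M (@mode_diff W) g i j = 0) -> forall i j,
  iter M.+1 (@mode_diff W)
    (fun i j => i%:~R *: g (i - 1) j + (γ * (i + 1)%:~R) *: g i j) i j = 0.
Proof.
elim: M g => [|M IH] g g0 i j.
  have {}g0 a b : g a b = 0 := g0 a b.
  by rewrite /= /mode_diff !g0 !scaler0 addr0 subrr.
have gM a b : iter M.+1 (@mode_diff W) (fun a b => γ *: g (a + 1) b) a b = 0.
  rewrite -(linear_iter_mode_diff M.+1 (fun a b => g (a + 1) b) a b (scale_linear γ)).
  have := iter_mode_diff_shift M.+1 g 1 0 a b; rewrite g0 => e.
  rewrite [X in γ *: X](_ : _ = 0) ?scaler0 // -[RHS]e; congr (iter _ _ _ _ _).
  by apply/funext => c; apply/funext => d; rewrite addr0.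
(* For D = -(1 + γz) ∂_z one has (z - w) D g = D ((z - w) g) + (1 + γz) g; [h] is the first summand
   on the right. *)
pose h i j := i%:~R *: mode_diff g (i - 1) j + (γ * (i + 1)%:~R) *: mode_diff g i j.
rewrite iterSr [X in iter _ _ X](_ : _ = fun i j => h i j + (g i j + γ *: g (i + 1) j)).
  rewrite (iter_mode_diffD _ h) (iter_mode_diffD _ g) g0 gM !addr0.
  by apply: IH => a b; rewrite -iterSr.
apply/funext => a; apply/funext => b; rewrite /h /mode_diff addrK subrK.
set c := γ * (a + 1)%:~R.
have -> : γ * (a + 1 + 1)%:~R = c + γ by rewrite /c intrD mulrDr mulr1.
rewrite intrD !scalerDl scale1r !scalerBr addrACA [LHS]addrAC; congr (_ + _).
by rewrite opprD addrACA.
Qed.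

(** * Uniqueness of local fields and the two mode formulas *)

Section ModeAlgebra.
Variables (A : comUnitRingType) (W : lmodType A) (γ : A) (hom : bool -> W -> Prop).
Variables (mode : int -> W -> W -> W) (one : W) (T : W -> W).
Hypothesis modeP : is_mode_algebra γ hom mode one T.
Hypothesis natU : forall n, n.+1%:R \is a @GRing.unit A.

Implicit Types (E F : int -> W -> W).

Definition scomm (p q : bool) E F v : int -> int -> W :=
  fun i j => E i (F j v) - (-1) ^+ (p * q) *: F j (E i v).

Definition mutually_local p q E F := exists M : nat,
  forall v i j, iter M (@mode_diff W) (scomm p q E F v) i j = 0.

Definition local_field p E := forall q c, hom q c -> mutually_local p q E (mode^~ c).

Let modeL n x : linear (mode n x) := mode_linr modeP n x.

Let homogeneous_ind (P : W -> Prop) :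
  (forall p x, hom p x -> P x) -> (forall x y, P x -> P y -> P (x + y)) -> forall x, P x.
Proof.
move=> Phom PD x; have [_ _ /(_ x)[x0 [x1 [h0 h1 ->]]] _] := mode_grading modeP.
by apply: PD; apply: Phom; eassumption.
Qed.

(* Goddard's uniqueness theorem *)
Lemma local_field_unique p E F :
  (forall n, linear (E n)) -> (forall n, linear (F n)) ->
  local_field p E -> local_field p F -> (forall n, E n one = F n one) ->
  forall n c, E n c = F n c.
Proof.
move=> EL FL Eloc Floc EF n; apply: homogeneous_ind => [q c hc|x y].
  have [M E0] := Eloc q c hc; have [M' F0] := Floc q c hc.
  (* Since E and F agree on the vacuum, the difference of their supercommutators with c(w), applied
     to the vacuum, is [G], the difference E - F applied to c(w)1. It is regular in w, and c(w)1 has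
     value c at w = 0. *)
  pose K := maxn M M'; pose G i j := E i (mode j c one) - F i (mode j c one).
  have GE : G = fun i j => scomm p q E (mode^~ c) one i j + - scomm p q F (mode^~ c) one i j.
    apply/funext => i; apply/funext => j.
    by rewrite /scomm EF opprB addrA subrK.
  have Greg i j : 0 <= j -> G i j = 0.
    by move=> j0; rewrite /G (mode1r_reg modeP) // (linfun0 (EL i)) (linfun0 (FL i)) subrr.
  (* The first index is chosen so that the shift by [K] lands on n. *)
  have := iter_mode_diff_regular K (n - K%:Z) Greg.
  rewrite GE iter_mode_diffD iter_mode_diffN.
  rewrite (iter_mode_diff_le (leq_maxl M M') (E0 one)).
  rewrite (iter_mode_diff_le (leq_maxr M M') (F0 one)) subr0.
  rewrite -[RHS]/(_ + - _) -[LHS](subrr 0) => /esym/eqP.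
  have := congr1 (fun g => g (n - K%:Z + K%:Z) (-1)) GE; rewrite /G => <-.
  by rewrite (mode1r modeP) subrK subr0 subr_eq0 => /eqP.
by rewrite (linfunD (EL n)) (linfunD (FL n)) => -> ->.
Qed.

Lemma mode_field_local p x : hom p x -> local_field p (mode^~ x).
Proof. by move=> hx q c hc; exact: (mode_local modeP hx hc). Qed.

Lemma transl_mode k x y : T (mode (-1 - k%:Z) x y) = mode (-1 - k%:Z) x (T y) +
  (k.+1%:R *: mode (-1 - k.+1%:Z) x y + (γ * k%:R) *: mode (-1 - k%:Z) x y).
Proof.
have /(canRL (subrK _)) -> := transl_comm modeP (-1 - k%:Z) x y.
rewrite addrC -scaleNr -scaleNr; congr (_ + (_ *: mode _ _ _ + _ *: _)).
- by rewrite -mulrNz -[RHS]/((k.+1)%:Z%:~R) ; congr _%:~R; lia.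
- by lia.
- by rewrite -mulrN -mulrNz -[in RHS]/((k)%:Z%:~R); congr (_ * _%:~R); lia.
Qed.

Lemma transl_mode1 k x : T (mode (-1 - k%:Z) x one) =
  k.+1%:R *: mode (-1 - k.+1%:Z) x one + (γ * k%:R) *: mode (-1 - k%:Z) x one.
Proof. by rewrite transl_mode (transl1 modeP) (linfun0 (modeL _ _)) add0r. Qed.

(** The invertibility of k + 1 determines each term from the preceding one. By [transl_mode1] the
    coefficients of x(u)1 satisfy this recursion, so it serves to compare fields on the vacuum. *)
Lemma transl_rec_unique (e f : nat -> W) : e 0%N = f 0%N ->
  (forall k, T (e k) = k.+1%:R *: e k.+1 + (γ * k%:R) *: e k) ->
  (forall k, T (f k) = k.+1%:R *: f k.+1 + (γ * k%:R) *: f k) -> e =1 f.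
Proof.
move=> ef0 eT fT; elim=> [//|k IH].
apply: (unit_scalerI (natU k)).
by apply: (addIr ((γ * k%:R) *: e k)); rewrite -eT {2}IH -fT IH.
Qed.

(** Both (Tx)(u) and (1 + γu) ∂_u x(u) are local fields, the second by [iter_mode_diff_transl]. They
    agree on the vacuum, so uniqueness applies. *)
Lemma mode_transl n x y : mode n (T x) y =
  - (n%:~R *: mode (n - 1) x y) - (γ * (n + 1)%:~R) *: mode n x y.
Proof.
move: x; apply: homogeneous_ind => [p x hx|x x']; last first.
  rewrite (linfunD (transl_lin modeP)) !(linfunD (mode_linl modeP _ y)) => -> ->.
  by rewrite !scalerDr !opprD addrACA.
pose F i y := - (i%:~R *: mode (i - 1) x y) - (γ * (i + 1)%:~R) *: mode i x y.
have FL i : linear (F i).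
  move=> c u v; rewrite /F !(modeL _ _ c u v) !scalerDr !scalerN !opprD addrACA.
  by rewrite !scalerA ![c * _]mulrC.
apply: (@local_field_unique p (mode^~ (T x)) F) => // [|q c hc|{n y}n].
- exact/mode_field_local/(transl_hom modeP).
- have [M g0] := mode_field_local hx hc; exists M.+1 => v i j.
  apply/eqP; rewrite -oppr_eq0 -iter_mode_diffN; apply/eqP.
  rewrite -[RHS](iter_mode_diff_transl γ (g0 v) i j); congr (iter _ _ _ _ _).
  apply/funext => a; apply/funext => b; rewrite /scomm /F.
  rewrite (linfunB _ _ (modeL b c)) (linfunN _ (modeL b c)) !(linfunZ (modeL b c)).
  rewrite !scalerBr !scalerN !opprD !opprK !scalerA.
  rewrite ![_ * a%:~R]mulrC ![_ * (γ * _)]mulrC -!scalerA.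
  by rewrite addrACA.
(* As T kills the vacuum, the derivative field applied to the vacuum is T x(u)1. It satisfies the
   same recursion as (Tx)(u)1, with the same initial term Tx. *)
rewrite /F -(transl_comm modeP) (transl1 modeP) (linfun0 (modeL _ _)) subr0.
have [n0|n0] := lerP 0 n.
  by rewrite !(mode1r_reg modeP) // (linfun0 (transl_lin modeP)).
have -> : n = -1 - (absz (n + 1))%:Z by lia.
apply: (transl_rec_unique (e := fun k => mode (-1 - k%:Z) (T x) one)
  (f := fun k => T (mode (-1 - k%:Z) x one))) => [|k|k].
- by rewrite subr0 !(mode1r modeP).
- exact: transl_mode1.
- by rewrite -!(linfunZ (transl_lin modeP)) -(linfunD (transl_lin modeP)) -transl_mode1.
Qed.

Lemma mode_fin x n y : ultimately0 (fun i : nat => mode (n + i%:Z) x y).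
Proof.
have [n0 x0] := mode_trunc modeP x y; exists (absz (n0 - n)) => i lei.
by apply: x0; lia.
Qed.

Let mode_fin1 x n y z : ultimately0 (fun i : nat => mode (n - i%:Z) z (mode i%:Z x y)).
Proof.
have [B x0] := mode_fin x 0 y; exists B => i /x0; rewrite add0r => ->.
exact: linfun0 (modeL _ _).
Qed.

Let mode_fin2 x m n y z :
  ultimately0 (fun i : nat => mode (m - i%:Z) z (mode (n + i%:Z) x y)).
Proof.
by have [B x0] := mode_fin x n y; exists B => i /x0 ->; exact: linfun0 (modeL _ _).
Qed.

(** The n-th mode of the normally ordered product of x(u) and y(u): modes of x of index at most -1
    stand on the left of y, the others on the right with the sign s. *)
Definition normal_order (s : A) x y n v :=
  nsum (fun i : nat => mode (-1 - i%:Z) x (mode (n + i%:Z) y v)) +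
  s *: nsum (fun i : nat => mode (n - 1 - i%:Z) y (mode i%:Z x v)).

Lemma normal_order_linear s x y n : linear (normal_order s x y n).
Proof.
move=> c u v; rewrite /normal_order.
rewrite (@eq_nsum _ _ (fun i : nat => c *: mode (-1 - i%:Z) x (mode (n + i%:Z) y u) +
  mode (-1 - i%:Z) x (mode (n + i%:Z) y v))) => [|i]; last by rewrite !modeL.
rewrite (@eq_nsum _ (fun i : nat => mode _ y _) (fun i : nat =>
  c *: mode (n - 1 - i%:Z) y (mode i%:Z x u) +
  mode (n - 1 - i%:Z) y (mode i%:Z x v))) => [|i]; last by rewrite !modeL.
have scfin g : ultimately0 g -> ultimately0 (fun i => c *: g i).
  by move=> [B g0]; exists B => i /g0 ->; rewrite scaler0.
rewrite !nsumD //; try exact/scfin; rewrite -!(linear_nsum (scale_linear c)) //.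
by rewrite !scalerDr addrACA !scalerA [c * s]mulrC.
Qed.

(** The two sums of [normal_order] are the residues of the two orderings of the product against the
    two expansions of 1/(x - y), so Dong's lemma applies with the locality orders of the three
    pairs. *)
Lemma normal_order_local p q x y : hom p x -> hom q y ->
  local_field (p (+) q) (normal_order ((-1) ^+ (p * q)) x y).
Proof.
move=> hx hy r c hc.
have [s xy] := mode_field_local hx hy; have [t xc] := mode_field_local hx hc.
have [u yc] := mode_field_local hy hc; exists (s + t + u)%N => v.
set spq : A := (-1) ^+ (p * q); pose spr : A := (-1) ^+ (p * r).
pose sqr : A := (-1) ^+ (q * r).
have mode0 n z : mode n z 0 = 0 by exact: linfun0 (modeL n z).
(* [H1 - K1] is the supercommutator of the product x y with c, and [H2 - K2] is that of the product
   y x multiplied by its exchange sign. *)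
pose H1 i j k := mode i x (mode j y (mode k c v)).
pose K1 i j k := (spr * sqr) *: mode k c (mode i x (mode j y v)).
pose H2 i j k := spq *: mode j y (mode i x (mode k c v)).
pose K2 i j k := (spq * spr * sqr) *: mode k c (mode j y (mode i x v)).
have b2 : bounded2 (fun i j k => H1 i j k - K1 i j k).
  move=> k; have [J yJ] := mode_trunc modeP y (mode k c v).
  have [J' yJ'] := mode_trunc modeP y v; exists (`|J| + `|J'|) => i j leJ.
  by rewrite /H1 /K1 yJ ?yJ' ?mode0 ?scaler0 ?subrr //; lia.
have b1 : bounded1 (fun i j k => H2 i j k - K2 i j k).
  move=> k; have [J xJ] := mode_trunc modeP x (mode k c v).
  have [J' xJ'] := mode_trunc modeP x v; exists (`|J| + `|J'|) => i j leJ.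
  by rewrite /H2 /K2 xJ ?xJ' ?mode0 ?scaler0 ?subrr //; lia.
have scmodeL s' k : linear (fun w => s' *: mode k c w).
  by move=> d w w'; rewrite modeL scalerDr !scalerA mulrC.
have scfin (s' : A) g : ultimately0 g -> ultimately0 (fun i => s' *: g i : W).
  by move=> [B g0]; exists B => i /g0 ->; rewrite scaler0.
have scmfin (s' : A) k g : ultimately0 g -> ultimately0 (fun i => s' *: mode k c (g i) : W).
  by move=> [B g0]; exists B => i /g0 ->; rewrite mode0 scaler0.
have -> : scomm (p (+) q) r (normal_order spq x y) (mode^~ c) v = fun j k =>
    res_above (fun i j k => H1 i j k - K1 i j k) j k +
    res_below (fun i j k => H2 i j k - K2 i j k) j k.
  apply/funext => j; apply/funext => k; rewrite /scomm /normal_order /res_above /res_below.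
  rewrite sign_addb_mul -/spr -/sqr (linfunD (modeL _ _)) (linfunZ (modeL _ _)).
  rewrite scalerDr scalerA opprD addrACA; congr (_ + _).
    rewrite nsumB; [|exact: mode_fin2|exact/scmfin/mode_fin2].
    by rewrite -(linear_nsum (scmodeL _ k)) //; exact: mode_fin2.
  rewrite nsumB; [|exact/scfin/mode_fin1|exact/scmfin/mode_fin1].
  rewrite -(linear_nsum (scale_linear spq)); last exact: mode_fin1.
  rewrite -(linear_nsum (scmodeL _ k)); last exact: mode_fin1.
  by rewrite mulrC mulrA.
apply: dong => //.
(* The difference of the two distributions is [x, y] c v minus a sign times c [x, y] v; both terms
   are killed by the locality of x and y. *)
- apply/funext => i; apply/funext => j; apply/funext => k; rewrite !iter_diff12.
  apply/eqP; rewrite -subr_eq0 -iter_mode_diffN -iter_mode_diffD; apply/eqP.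
  pose L w := - ((spr * sqr) *: mode k c w).
  have LL : linear L by move=> d w w'; rewrite /L scmodeL opprD scalerN.
  transitivity (iter s (@mode_diff W) (scomm p q (mode^~ x) (mode^~ y) (mode k c v)) i j +
     L (iter s (@mode_diff W) (scomm p q (mode^~ x) (mode^~ y) v) i j)); last first.
    by rewrite !xy (linfun0 LL) addr0.
  rewrite (linear_iter_mode_diff _ _ _ _ LL) -iter_mode_diffD; congr (iter _ _ _ _ _).
  apply/funext => a; apply/funext => b; rewrite /L /scomm /H1 /H2 /K1 /K2 -/spq.
  rewrite (linfunB _ _ (modeL _ _)) (linfunZ (modeL _ _)) scalerBr scalerA.
  by rewrite [spr * sqr * spq]mulrC mulrA subrACA.
(* Leibniz rule: [xy, c] = x [y, c] + (-1)^(qr) [x, c] y. *)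
- apply: (@iter_diff_split _ _ _ _
    (fun i j k => mode i x (scomm q r (mode^~ y) (mode^~ c) v j k))
    (fun i j k => sqr *: scomm p r (mode^~ x) (mode^~ c) (mode j y v) i k)) => i j k.
  + rewrite /scomm /H1 /K1 (linfunB _ _ (modeL _ _)) (linfunZ (modeL _ _)).
    by rewrite scalerBr scalerA -/spr -/sqr [sqr * _]mulrC addrA subrK.
  + by rewrite -(linear_iter_mode_diff _ _ _ _ (modeL i x)) yc mode0.
  + by rewrite -(linear_iter_mode_diff _ _ _ _ (scale_linear sqr)) xc scaler0.
(* Leibniz rule in the other order: [yx, c] = (-1)^(pr) [y, c] x + y [x, c], multiplied by
   (-1)^(pq). *)
- apply: (@iter_diff_split _ _ _ _
    (fun i j k => (spq * spr) *: scomm q r (mode^~ y) (mode^~ c) (mode i x v) j k)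
    (fun i j k => spq *: mode j y (scomm p r (mode^~ x) (mode^~ c) v i k))) => i j k.
  + rewrite /scomm /H2 /K2 (linfunB _ _ (modeL _ _)) (linfunZ (modeL _ _)).
    by rewrite !scalerBr !scalerA -/spr -/sqr [RHS]addrC addrA subrK.
  + by rewrite -(linear_iter_mode_diff _ _ _ _ (scale_linear _)) yc scaler0.
  + have L : linear (fun w => spq *: mode j y w).
      by move=> d w w'; rewrite modeL scalerDr !scalerA mulrC.
    by rewrite -(linear_iter_mode_diff _ _ _ _ L) xc mode0 scaler0.
Qed.

Lemma normal_order1 s x y n : normal_order s x y n one =
  nsum (fun i : nat => mode (-1 - i%:Z) x (mode (n + i%:Z) y one)).
Proof.
rewrite /normal_order [X in s *: X]nsum0 ?scaler0 ?addr0 // => i.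
by rewrite (mode1r_reg modeP) // (linfun0 (modeL _ _)).
Qed.

(** The convolutions are the coefficients of the normally ordered product on the vacuum. By the
    Leibniz rule for T they satisfy the recursion of [transl_rec_unique]. *)
Lemma transl_conv x y k :
  let C i l := mode (-1 - i%:Z) x (mode (-1 - l%:Z) y one) in
  T (\sum_(i < k.+1) C i (k - i)%N) = k.+1%:R *: (\sum_(i < k.+2) C i (k.+1 - i)%N) +
    (γ * k%:R) *: \sum_(i < k.+1) C i (k - i)%N.
Proof.
move=> C; have TC i l : T (C i l) =
    i.+1%:R *: C i.+1 l + l.+1%:R *: C i l.+1 + (γ * (i + l)%:R) *: C i l.
  rewrite /C transl_mode transl_mode1 (linfunD (modeL _ _)) !(linfunZ (modeL _ _)).
  rewrite addrACA [l.+1%:R *: _ + _]addrC; congr (_ + _).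
  by rewrite -scalerDl -mulrDr -natrD addnC.
rewrite (big_morph T (linfunD (transl_lin modeP)) (linfun0 (transl_lin modeP))).
(* The weight k + 1 is split as i + (k + 1 - i) on the antidiagonal. The first part loses its term i
   = 0, the second its term i = k + 1, and both become sums over i <= k. *)
have -> : k.+1%:R *: (\sum_(i < k.+2) C i (k.+1 - i)%N) =
    \sum_(i < k.+1) (i.+1%:R *: C i.+1 (k - i)%N + (k - i)%N.+1%:R *: C i (k - i)%N.+1).
  rewrite scaler_sumr (eq_bigr (fun i : 'I_k.+2 =>
      i%:R *: C i (k.+1 - i)%N + (k.+1 - i)%:R *: C i (k.+1 - i)%N)) => [|i _]; last first.
    by rewrite -scalerDl -natrD subnKC // -ltnS ltn_ord.
  rewrite !big_split /= big_ord_recl scale0r add0r; congr (_ + _).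
  rewrite big_ord_recr /= subnn scale0r addr0; apply: eq_bigr => i _.
  by rewrite subSn // -ltnS ltn_ord.
rewrite scaler_sumr -big_split; apply: eq_bigr => i _.
by rewrite TC subnKC // -ltnS ltn_ord.
Qed.

(** Both sides are local fields, the right one by Dong's lemma. On the vacuum their coefficients
    start with x_(-1) y and obey the same recursion, so the uniqueness theorem identifies them. *)
Theorem mode_mode_m1 p q x y n z : hom p x -> hom q y ->
  mode n (mode (-1) x y) z = normal_order ((-1) ^+ (p * q)) x y n z.
Proof.
move=> hx hy; set s := _ ^+ _.
have hxy := mode_hom modeP (-1) hx hy.
apply: (@local_field_unique (p (+) q) (mode^~ (mode (-1) x y)) (normal_order s x y)) => //.
- exact: normal_order_linear.
- exact: mode_field_local.
- exact: normal_order_local.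
move=> {z}n; rewrite normal_order1; have [n0|n0] := lerP 0 n.
  rewrite (mode1r_reg modeP) // nsum0 // => i.
  by rewrite (mode1r_reg modeP) ?(linfun0 (modeL _ _)) //; lia.
pose C i l := mode (-1 - i%:Z) x (mode (-1 - l%:Z) y one).
have -> : n = -1 - (absz (n + 1))%:Z by lia.
move: (absz _) => {n n0}.
have nsumC k : nsum (fun i : nat => mode (-1 - i%:Z) x (mode (-1 - k%:Z + i%:Z) y one)) =
    \sum_(i < k.+1) C i (k - i)%N.
  rewrite (@nsumE _ k.+1) => [|i lei].
    apply: eq_bigr => i _; rewrite /C; congr (mode _ _ (mode _ _ _)).
    by have := ltn_ord i; lia.
  by rewrite (mode1r_reg modeP) ?(linfun0 (modeL _ _)) //; lia.
apply: transl_rec_unique => [|k|k].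
- by rewrite nsumC big_ord1 /C !subr0 !(mode1r modeP).
- exact: transl_mode1.
- by rewrite !nsumC transl_conv.
Qed.

End ModeAlgebra.

(** * The coordinate (e^(γz) - 1)/γ *)

Section PowerSeries.
Variable A : comNzRingType.
Implicit Types (f g : pseries A) (c : A).

Definition psC c : pseries A := PSeries (fun n => if n == 0%N then c else 0).
Definition psX : pseries A := PSeries (fun n => (n == 1%N)%:R).
(** The derivation z d/dz, which, unlike d/dz, leaves the degree unchanged. *)
Definition ps_euler f : pseries A := PSeries (fun n => n%:R * f n).

Lemma psCM_coef c f n : (psC c * f) n = c * f n.
Proof. by rewrite ps_coefM big_ord_recl /= subn0 big1 ?addr0 // => i _; rewrite mul0r. Qed.

Lemma psXM_coef f n : (psX * f) n = if n is n'.+1 then f n' else 0.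
Proof.
rewrite ps_coefM; case: n => [|n]; first by rewrite big_ord1 /= mul0r.
rewrite big_ord_recl /= mul0r add0r big_ord_recl /= mul1r subSS subn0.
by rewrite big1 ?addr0 // => i _; rewrite mul0r.
Qed.

Lemma psCM c d : psC (c * d) = psC c * psC d.
Proof. by apply: ps_ext => n; rewrite psCM_coef /=; case: eqP; rewrite ?mulr0. Qed.

Lemma psC_sum I r (P : pred I) (F : I -> A) :
  psC (\sum_(i <- r | P i) F i) = \sum_(i <- r | P i) psC (F i).
Proof.
apply: (big_morph psC) => [c d|]; apply: ps_ext => n; rewrite ?ps_coefD /=; case: eqP => //.
by rewrite addr0.
Qed.

Lemma ps_coefMz f k n : (k%:~R * f) n = k%:~R * f n.
Proof.
have coefMn m : (f *+ m) n = f n *+ m by elim: m => // m IH; rewrite !mulrS -IH.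
by rewrite !mulrzl; case: k => m; rewrite ?NegzE ?mulrNz ?ps_coefN -!pmulrn coefMn.
Qed.

Lemma ps_coef0M f g : (f * g) 0%N = f 0%N * g 0%N.
Proof. by rewrite ps_coefM big_ord1 subn0. Qed.

Lemma ps_coef0X f n : (f ^+ n) 0%N = f 0%N ^+ n.
Proof. by elim: n => // n IH; rewrite !exprS ps_coef0M IH. Qed.

Lemma ps_eulerM f g : ps_euler (f * g) = ps_euler f * g + f * ps_euler g.
Proof.
apply: ps_ext => n; rewrite ps_coefD -[LHS]/(n%:R * (f * g) n).
rewrite !ps_coefM -big_split mulr_sumr.
apply: eq_bigr => i _ /=; rewrite -{1}(@subnKC i n) -1?ltnS ?ltn_ord // natrD; ring.
Qed.

End PowerSeries.

Section KernelSeries.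
Variables (A : comUnitRingType) (γ : A).
Hypothesis natU : forall n, n.+1%:R \is a @GRing.unit A.

Local Notation e := (ps_exp γ).
Local Notation u := (ps_expquo γ).

Let u0 : u 0%N = 1. Proof. by rewrite /= expr0 divr1. Qed.
Let e0 : e 0%N = 1. Proof. by rewrite /= expr0 divr1. Qed.

(* z^-k times (e^(γz) - 1)^k γ^-k e^(γz) *)
Definition kser (k : int) : pseries A :=
  match k with Posz n => e * u ^+ n | Negz n => e * ps_inv u ^+ n.+1 end.

Lemma kserS k : kser (k + 1) = kser k * u.
Proof.
case: k => [n|[|n]].
- have -> : n%:Z + 1 = n.+1%:Z by lia.
  by rewrite /kser exprSr mulrA.
- have -> : Negz 0 + 1 = Posz 0 by [].
  by rewrite /kser expr0 expr1 mulr1 -mulrA [_ * u]mulrC ps_mulV // mulr1.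
- have -> : Negz n.+1 + 1 = Negz n by rewrite !NegzE; lia.
  by rewrite /kser [ps_inv u ^+ n.+2]exprSr mulrA -!mulrA [_ * u]mulrC ps_mulV // mulr1.
Qed.

Lemma kser_neg n : kser (- n%:Z) = kernel_num γ n.
Proof. by case: n => [|n] //; rewrite -NegzE. Qed.

Lemma kser0 k : kser k 0%N = 1.
Proof.
have ui0 : ps_inv u 0%N = 1.
  by have := congr1 (fun f => pscoef f 0%N) (ps_mulV u0); rewrite ps_coef0M u0 mul1r.
by case: k => n; rewrite /kser ps_coef0M e0 ps_coef0X ?u0 ?ui0 expr1n mulr1.
Qed.

Lemma fact_unit n : n`!%:R \is a @GRing.unit A.
Proof. by rewrite -(prednK (fact_gt0 n)) natU. Qed.

(** Equivalently, the derivative of z u(z) is e^(γz). *)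
Let euler_u : ps_euler u = e - u.
Proof.
apply: ps_ext => n; rewrite ps_coefD ps_coefN /= factS natrM invrM ?natU ?fact_unit //.
have -> : n%:R = n.+1%:R - 1 :> A by rewrite -natr1 addrK.
by rewrite mulrBl mul1r; congr (_ - _); rewrite mulrC -!mulrA mulVr ?natU // mulr1.
Qed.

Let euler_e : ps_euler e = psC γ * psX A * e.
Proof.
apply: ps_ext => n; rewrite -mulrA psCM_coef psXM_coef; case: n => [|n] /=.
  by rewrite mul0r mulr0.
rewrite factS natrM invrM ?natU ?fact_unit // exprS.
by rewrite mulrCA -!mulrA; congr (_ * (_ * _)); rewrite mulrCA divrr ?natU // mulr1.
Qed.

(** Put t = (e^(γz) - 1)/γ, so t' = 1 + γt and [kser k] is z^-k t^k t'. The identity is (t^k t')' =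
    k t^(k-1) t' + γ(k+1) t^k t', multiplied by z^(1-k). *)
Lemma kser_rec k : ps_euler (kser k) + k%:~R * kser k =
  k%:~R * kser (k - 1) + (k + 1)%:~R * (psC γ * psX A * kser k).
Proof.
(* The defect [d] of the identity is multiplied by the invertible series u when k increases by one.
   It therefore suffices that it vanishes at k = 0. *)
pose d k := ps_euler (kser k) + k%:~R * kser k - k%:~R * kser (k - 1)
  - (k + 1)%:~R * (psC γ * psX A * kser k).
have eE : e = 1 + psC γ * psX A * u.
  by apply/eqP; rewrite addrC -subr_eq; apply/eqP; exact: ps_expquoE.
have dS j : d (j + 1) = d j * u.
  rewrite /d kserS ps_eulerM euler_u addrK {1}eE.
  have -> : kser j = kser (j - 1) * u by rewrite -kserS subrK.
  by rewrite !intrD; ring.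
have u_inj : injective ( *%R^~ u).
  by move=> f g /(congr1 ( *%R^~ (ps_inv u))) /=; rewrite -!mulrA ps_mulV // !mulr1.
suff d0 : d k = 0 by apply/eqP; rewrite -subr_eq0 opprD addrA -/(d k) d0.
elim/int_ind: k => [|n IH|n IH].
- have k0 : kser 0 = e := mulr1 _.
  by rewrite /d k0 euler_e add0r mulr0z mulr1z !mul0r subr0 addr0 mul1r subrr.
- have -> : n.+1%:Z = n%:Z + 1 by lia.
  by rewrite dS IH mul0r.
- apply: u_inj; rewrite -dS mul0r -[RHS]IH; congr (d _); lia.
Qed.

(** In the coordinate t of [kser_rec] this is the residue of t^(-1-n) dt. It follows by comparing
    coefficients in [kser_rec], that is, from the vanishing of the residue of a derivative. *)
Lemma kser_residue n : kser (-1 - n%:Z) n = (n == 0%N)%:R.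
Proof.
elim: n => [|n IH]; first by rewrite kser0.
have := congr1 (fun f => pscoef f n.+1) (kser_rec (-1 - n%:Z)).
rewrite !ps_coefD !ps_coefMz -mulrA psCM_coef psXM_coef {}IH.
have nz : (-1 - n%:Z)%:~R = - n.+1%:R :> A.
  by rewrite -[n.+1%:R]/(n.+1%:Z%:~R) -mulrNz; congr _%:~R; lia.
(* The left-hand side vanishes in degree n + 1. The γ-term vanishes too, through its factor -n if n
   = 0 and by the induction hypothesis otherwise. *)
rewrite nz mulNr addrN => /esym; case: n {nz} => [|n].
  rewrite (_ : -1 - 0 + 1 = 0 :> int) // mul0r addr0 => /eqP.
  by rewrite mulN1r oppr_eq0 => /eqP; apply: etrans; congr (kser _ _); lia.
rewrite !mulr0 addr0 mulNr => /eqP; rewrite oppr_eq0 => /eqP.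
move=> /(congr1 ( *%R n.+2%:R^-1)); rewrite mulr0 mulKr ?natU // => e0'.
by rewrite -[RHS]e0'; congr (kser _ _); lia.
Qed.

End KernelSeries.

(** * Multiplication of formal distributions by power series in two variables *)

Section BivariateAction.
Variables (A : comNzRingType) (W : lmodType A).
Implicit Types (g : int -> int -> W) (F G : pseries (pseries A)).

(** Both sides are the sum over the triangle a + c < B, outside which φ vanishes. *)
Lemma sum_antidiagonal (B : nat) (φ : nat -> nat -> W) :
  (forall a c, (B <= a + c)%N -> φ a c = 0) ->
  \sum_(a < B) \sum_(c < B) φ a c = \sum_(m < B) \sum_(a < m.+1) φ a (m - a)%N.
Proof.
move=> φ0.
transitivity (\sum_(0 <= m < B) \sum_(0 <= a < B | (a <= m)%N) φ a (m - a)%N); last first.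
  rewrite big_mkord; apply: eq_bigr => -[m /= ltm] _.
  rewrite -(big_mkord xpredT (fun a => φ a (m - a)%N)).
  by rewrite (big_nat_widen 0 m.+1 B).
rewrite (exchange_big_dep_nat predT) //= big_mkord; apply: eq_bigr => -[a /= lta] _.
rewrite -(@big_nat_widenl _ _ _ a 0 B xpredT (fun m => φ a (m - a)%N)) //.
rewrite -[X in index_iota X _]add0n big_addn big_mkord.
rewrite (big_ord_widen B (fun c => φ a (c + a - a)%N)) ?leq_subr //.
rewrite [RHS]big_mkcond /=; apply: eq_bigr => c _; rewrite addnK; case: ifPn => //.
by rewrite -leqNgt leq_subLR => /φ0.
Qed.

(* the coefficients of a formal distribution in W((z))((w)) + W((w))((z)) *)
Definition boxed g := forall n : int, exists B : int, forall i j,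
  n <= i -> n <= j -> B <= i \/ B <= j -> g i j = 0.

(* F b a is the coefficient of z^a w^b in F *)
Definition bact F g i j : W :=
  nsum (fun b : nat => nsum (fun a : nat => F b a *: g (i + a%:Z) (j + b%:Z))).

Lemma boxed_at g i j : boxed g -> exists B : nat, forall a b : nat,
  (B <= a)%N \/ (B <= b)%N -> g (i + a%:Z) (j + b%:Z) = 0.
Proof.
move=> /(_ (- (`|i| + `|j|)))[B g0]; exists (absz (`|B| + `|i| + `|j|)) => a b leB.
by apply: g0; lia.
Qed.

Lemma bactE (B : nat) F g i j :
  (forall a b : nat, (B <= a)%N \/ (B <= b)%N -> g (i + a%:Z) (j + b%:Z) = 0) ->
  bact F g i j = \sum_(b < B) \sum_(a < B) F b a *: g (i + a%:Z) (j + b%:Z).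
Proof.
move=> g0; rewrite /bact (@nsumE _ B) => [|b leB]; last first.
  by apply: nsum0 => a; rewrite g0 ?scaler0 //; right.
by apply: eq_bigr => b _; rewrite (@nsumE _ B) // => a leB; rewrite g0 ?scaler0 //; left.
Qed.

Lemma bact_box (B : nat) F g i j :
  (forall a b : nat, (B <= a)%N \/ (B <= b)%N -> g (i + a%:Z) (j + b%:Z) = 0) ->
  forall a b : nat, (B <= a)%N \/ (B <= b)%N -> bact F g (i + a%:Z) (j + b%:Z) = 0.
Proof.
move=> g0 a b leB; apply: nsum0 => d; apply: nsum0 => c; rewrite -!addrA -!PoszD.
rewrite g0 ?scaler0 //; lia.
Qed.

Lemma boxed_diff g : boxed g -> boxed (mode_diff g).
Proof.
move=> gb n; have [B g0] := gb n; exists B => i j lei lej leB.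
by rewrite /mode_diff !g0 ?subrr //; lia.
Qed.

Lemma boxedB (c : A) g h : boxed g -> boxed h -> boxed (fun i j => g i j - c *: h i j).
Proof.
move=> gb hb n; have [B g0] := gb n; have [C h0] := hb n.
by exists (`|B| + `|C|) => i j ? ? ?; rewrite g0 ?h0 ?scaler0 ?subrr //; lia.
Qed.

(** Once the support is confined to a box, the claim is the rearrangement of a finite fourfold sum
    along two antidiagonals. *)
Lemma bactM F G g i j : boxed g -> bact (F * G) g i j = bact F (bact G g) i j.
Proof.
move=> gb; have [B g0] := boxed_at i j gb.
rewrite (bactE _ (bact_box G g0)) (bactE _ g0).
pose ψ b d a c := (F b a * G d c) *: g (i + (a + c)%:Z) (j + (b + d)%:Z).
transitivity (\sum_(m < B) \sum_(b < m.+1) \sum_(a < B) \sum_(c < B) ψ b (m - b)%N a c).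
  apply: eq_bigr => -[m /= ltm] _.
  transitivity (\sum_(n < B) \sum_(b < m.+1) \sum_(a < n.+1) ψ b (m - b)%N a (n - a)%N).
    apply: eq_bigr => -[n /= ltn] _; rewrite ps_coef_sum scaler_suml.
    apply: eq_bigr => -[b /= ltb] _; rewrite scaler_suml.
    apply: eq_bigr => -[a /= lta] _; rewrite /ψ !subnKC //.
  rewrite exchange_big /=; apply: eq_bigr => b _.
  rewrite (@sum_antidiagonal B (fun a c => ψ b (m - b)%N a c)) // => a c leB.
  by rewrite /ψ g0 ?scaler0 //; left.
rewrite -(@sum_antidiagonal B (fun b d => \sum_(a < B) \sum_(c < B) ψ b d a c)); last first.
  move=> b d leB; rewrite big1 // => a _; rewrite big1 // => c _.
  by rewrite /ψ g0 ?scaler0 //; right.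
apply: eq_bigr => b _; rewrite exchange_big /=; apply: eq_bigr => a _.
rewrite (@bactE B) => [|c d leB]; last first.
  by rewrite -!addrA -!PoszD g0 //; lia.
rewrite scaler_sumr; apply: eq_bigr => d _; rewrite scaler_sumr; apply: eq_bigr => c _.
by rewrite /ψ scalerA !PoszD !addrA.
Qed.

Lemma bactB (c : A) F g h i j : boxed g -> boxed h ->
  bact F (fun i j => g i j - c *: h i j) i j = bact F g i j - c *: bact F h i j.
Proof.
move=> gb hb; have [B g0] := boxed_at i j gb; have [C h0] := boxed_at i j hb.
rewrite !(@bactE (B + C)); try by move=> a b leB; rewrite ?g0 ?h0 ?scaler0 ?subrr //; lia.
rewrite scaler_sumr -sumrB; apply: eq_bigr => b _.
rewrite scaler_sumr -sumrB; apply: eq_bigr => a _.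
by rewrite scalerBr !scalerA mulrC.
Qed.

Lemma bactBl F G g i j : boxed g ->
  bact (F - G) g i j = bact F g i j - bact G g i j.
Proof.
move=> gb; have [B g0] := boxed_at i j gb; rewrite !(bactE _ g0) -sumrB.
by apply: eq_bigr => b _; rewrite -sumrB; apply: eq_bigr => a _; rewrite -scalerBl.
Qed.

(* f(z) and f(w) *)
Definition ps_z1 (f : pseries A) : pseries (pseries A) := psC f.
Definition ps_z2 (f : pseries A) : pseries (pseries A) := PSeries (fun b => psC (f b)).

Lemma ps_z2M f h : ps_z2 (f * h) = ps_z2 f * ps_z2 h.
Proof.
apply: ps_ext => b; rewrite ps_coefM /= psC_sum.
by apply: eq_bigr => i _; rewrite psCM.
Qed.

Lemma ps_tensE f h b a : (ps_z1 f * ps_z2 h) b a = f a * h b.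
Proof. by rewrite /ps_z1 psCM_coef -[ps_z2 h b]/(psC (h b)) mulrC psCM_coef mulrC. Qed.

Lemma bact_z1 g i j : boxed g -> bact (ps_z1 (psX A)) g i j = g (i + 1) j.
Proof.
move=> gb; have [B g0] := boxed_at i j gb.
rewrite (@bactE B.+2) => [|a b leB]; last by apply: g0; lia.
rewrite big_ord_recl /= [X in _ + X]big1 => [|b _]; last first.
  by rewrite big1 // => a _; rewrite scale0r.
rewrite big_ord_recl /= scale0r add0r big_ord_recl /= scale1r.
rewrite big1 => [|a _]; last by rewrite scale0r.
by rewrite !addr0.
Qed.

Lemma bact_z2 g i j : boxed g -> bact (ps_z2 (psX A)) g i j = g i (j + 1).
Proof.
move=> gb; have [B g0] := boxed_at i j gb.
rewrite (@bactE B.+2) => [|a b leB]; last by apply: g0; lia.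
rewrite big_ord_recl /= big1 ?add0r => [|a _]; last by case: (a == _ :> nat); rewrite scale0r.
rewrite big_ord_recl /= [X in _ + X]big1 => [|b _]; last first.
  by rewrite big1 // => a _; case: (a == _ :> nat); rewrite scale0r.
rewrite big_ord_recl /= scale1r.
rewrite big1 => [|a _]; last by rewrite scale0r.
by rewrite !addr0.
Qed.

(* (z f(z) - w f(w)) / (z - w) *)
Definition diff_quot (f : pseries A) : pseries (pseries A) :=
  PSeries (fun b => PSeries (fun a => f (a + b)%N)).

Lemma diff_quotE f : ps_z1 (psX A * f) - ps_z2 (psX A * f) =
  diff_quot f * (ps_z1 (psX A) - ps_z2 (psX A)).
Proof.
rewrite [RHS]mulrC mulrBl; apply: ps_ext => b; rewrite !ps_coefD !ps_coefN.
apply: ps_ext => a; rewrite !ps_coefD !ps_coefN psCM_coef psXM_coef.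
have -> : (ps_z2 (psX A) * diff_quot f) b a = if b is b'.+1 then f (a + b')%N else 0.
  have -> : ps_z2 (psX A) = psX (pseries A).
    by apply: ps_ext => -[|[|n]]; apply: ps_ext => -[|k].
  by rewrite psXM_coef; case: b.
rewrite -[ps_z2 _ b a]/(if a == 0%N then (psX A * f) b else 0) psXM_coef /ps_z1.
case: a => [|a]; case: b => [|b]; rewrite ?psXM_coef /= ?addn0 ?add0n ?subrr ?subr0 //.
by rewrite addnS subrr.
Qed.

End BivariateAction.

(** * The mode axioms in the coordinate t = (e^(γz) - 1)/γ *)

Section CoordinateChange.
Variables (A : comUnitRingType) (W : lmodType A) (hom : bool -> W -> Prop).
Variables (mode : int -> W -> W -> W) (one : W) (T : W -> W).
Hypothesis modeP : is_mode_algebra 0 hom mode one T.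
Hypothesis natU : forall n, n.+1%:R \is a @GRing.unit A.
Variable γ : A.

(** The residue of t^k x(z) y dt, since t^k dt = z^k [kser k] dz. *)
Definition coord_mode (k : int) (x y : W) : W :=
  nsum (fun n : nat => kser γ k n *: mode (k + n%:Z) x y).

Let mode0 n x : mode n x 0 = 0. Proof. exact: linfun0 (mode_linr modeP n x). Qed.

Let mode_bound x y (k : int) : exists B : nat, forall n : nat,
  (B <= n)%N -> mode (k + n%:Z) x y = 0.
Proof.
have [n0 x0] := mode_trunc modeP x y; exists (absz (n0 - k)) => n len.
by apply: x0; lia.
Qed.

Let coord_mode_fin (c : nat -> A) x y (k : int) :
  ultimately0 (fun n : nat => c n *: mode (k + n%:Z) x y).
Proof. by have [B x0] := mode_bound x y k; exists B => n /x0 ->; rewrite scaler0. Qed.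

Let coord_linl n y : linear (fun x => coord_mode n x y).
Proof.
move=> c u v; rewrite /coord_mode (linear_nsum (scale_linear c)) // -nsumD //.
  by apply: eq_nsum => i; rewrite (mode_linl modeP) scalerDr !scalerA mulrC.
by have [B g0] := coord_mode_fin (kser γ n) u y n; exists B => i /g0 ->; rewrite scaler0.
Qed.

Let coord_linr n x : linear (coord_mode n x).
Proof.
move=> c u v; rewrite /coord_mode (linear_nsum (scale_linear c)) // -nsumD //.
  by apply: eq_nsum => i; rewrite (mode_linr modeP) scalerDr !scalerA mulrC.
by have [B g0] := coord_mode_fin (kser γ n) x u n; exists B => i /g0 ->; rewrite scaler0.
Qed.

Let coord_trunc x y : exists n0 : int, forall n, n0 <= n -> coord_mode n x y = 0.
Proof.
have [n0 x0] := mode_trunc modeP x y; exists n0 => n len; apply: nsum0 => i.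
by rewrite x0 ?scaler0 //; lia.
Qed.

(** The vacuum field is constant, so the claim is that t^n dt has residue 1 for n = -1 and 0
    otherwise. *)
Let coord_1l n y : coord_mode n one y = if n == -1 then y else 0.
Proof.
rewrite /coord_mode; have [n0|n0] := lerP 0 n.
  rewrite nsum0 => [|i]; first by case: eqP => // ?; lia.
  by rewrite (mode1l modeP); case: eqP => [?|_]; [lia|rewrite scaler0].
have -> : n = -1 - (absz (n + 1))%:Z by lia.
move: (absz _) => m {n0}; rewrite (@nsumE _ m.+1) => [|i lei]; last first.
  by rewrite (mode1l modeP); case: eqP => [?|_]; [lia|rewrite scaler0].
rewrite big_ord_recr big1 /= => [|i _]; last first.
  by rewrite (mode1l modeP); case: eqP => [?|_]; [have := ltn_ord i; lia|rewrite scaler0].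
rewrite add0r (mode1l modeP) kser_residue // subrK eqxx.
have -> : (-1 - m%:Z == -1) = (m == 0%N) by lia.
by case: eqP => _; rewrite ?scale1r ?scale0r.
Qed.

Let coord_1r_reg n x : 0 <= n -> coord_mode n x one = 0.
Proof. by move=> n0; apply: nsum0 => i; rewrite (mode1r_reg modeP) ?scaler0 //; lia. Qed.

Let coord_1r x : coord_mode (-1) x one = x.
Proof.
rewrite /coord_mode (@nsumE _ 1) => [|i i0]; last first.
  by rewrite (mode1r_reg modeP) ?scaler0 //; lia.
by rewrite big_ord1 addr0 (mode1r modeP) kser0 scale1r.
Qed.

(** T acts on x(z) as d/dz. Integration by parts moves the derivative to t^n t', where [kser_rec]
    evaluates it. *)
Let coord_transl n x y : T (coord_mode n x y) - coord_mode n x (T y) =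
  - (n%:~R *: coord_mode (n - 1) x y) - (γ * (n + 1)%:~R) *: coord_mode n x y.
Proof.
have Tscale c : linear (fun w => c *: T w).
  by move=> d u v; rewrite (transl_lin modeP) scalerDr !scalerA mulrC.
have modeT k : T (mode k x y) - mode k x (T y) = - (k%:~R *: mode (k - 1) x y).
  by rewrite (transl_comm modeP) mul0r scale0r subr0.
rewrite -opprD; apply: (canRL (@opprK _)); rewrite opprB.
(* All terms are paired with the modes from index n - 1 on; the mode of index n in t then belongs to
   the series z [kser n]. *)
pose G (c : nat -> A) := nsum (fun i : nat => c i *: mode (n - 1 + i%:Z) x y).
have GD c d : G (fun i => c i + d i) = G c + G d.
  by rewrite /G -nsumD //; apply: eq_nsum => i; rewrite scalerDl.
have GZ a c : G (fun i => a * c i) = a *: G c.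
  rewrite /G (linear_nsum (scale_linear a)) //.
  by apply: eq_nsum => i; rewrite scalerA.
have coordG : coord_mode n x y = G (fun i => (psX A * kser γ n) i).
  rewrite /G nsum_recl // psXM_coef scale0r add0r; apply: eq_nsum => i.
  by rewrite psXM_coef; congr (_ *: mode _ _ _); lia.
transitivity (G (fun i => (ps_euler (kser γ n) + n%:~R * kser γ n) i)).
  rewrite /coord_mode (linear_nsum (transl_lin modeP)) // -nsumB //; last first.
    by have [B g0] := coord_mode_fin (kser γ n) x y n; exists B => i /g0 ->;
       exact: linfun0 (transl_lin modeP).
  apply: eq_nsum => i; rewrite ps_coefD ps_coefMz /= (linfunZ (transl_lin modeP)).
  rewrite -scalerBr -opprB modeT opprK scalerA.
  have -> : n + i%:Z - 1 = n - 1 + i%:Z by lia.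
  congr (_ *: _); rewrite intrD -pmulrn; ring.
rewrite kser_rec // [in LHS]/G.
under eq_nsum => i do rewrite ps_coefD !ps_coefMz -mulrA psCM_coef.
rewrite -/(G (fun i => n%:~R * kser γ (n - 1) i +
  (n + 1)%:~R * (γ * (psX A * kser γ n) i))) GD !GZ coordG scalerA.
by rewrite [_ * γ]mulrC.
Qed.

Let coord_hom p q x y n : hom p x -> hom q y -> hom (p (+) q) (coord_mode n x y).
Proof.
move=> hx hy; have [h0 hZ _ _] := mode_grading modeP.
apply: (nsum_closed (P := hom (p (+) q))) => // [u v hu hv|i].
  by rewrite -[u]scale1r; apply: hZ.
by rewrite -[X in hom _ X]addr0; apply: hZ => //; exact: (mode_hom modeP).
Qed.

(** For F = 1 this is the change of coordinate in both variables. The factor F collects the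
    quotients (t(z) - t(w))/(z - w) during the induction. *)
Let coord_bact (g : int -> int -> W) k l F :=
  bact (ps_z1 (kser γ k) * ps_z2 (kser γ l) * F) g k l.

(* Locality in u: (u(z) - u(w))^M is a multiple of (z - w)^M. *)
Let iter_coord_bact M F (g : int -> int -> W) k l : boxed g ->
  iter M (@mode_diff W) (fun k l => coord_bact g k l F) k l =
  coord_bact (iter M (@mode_diff W) g) k l (F * diff_quot (ps_expquo γ) ^+ M).
Proof.
elim: M F g k l => [|M IH] F g k l gb; first by rewrite mulr1.
rewrite !iterSr [X in iter M _ X](_ : _ =
    fun k l => coord_bact (mode_diff g) k l (F * diff_quot (ps_expquo γ))).
  by rewrite IH ?exprS ?mulrA //; exact: boxed_diff.
apply/funext => {}k; apply/funext => {}l; rewrite /mode_diff /coord_bact.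
have z1g i j : bact (ps_z1 (psX A)) g i j = g (i + 1) j by exact: bact_z1.
have z2g i j : bact (ps_z2 (psX A)) g i j = g i (j + 1) by exact: bact_z2.
have shift1 H i j : bact H g (i + 1) j = bact (H * ps_z1 (psX A)) g i j.
  rewrite bactM //; apply: eq_nsum => b; apply: eq_nsum => a.
  by rewrite z1g addrAC.
have shift2 H i j : bact H g i (j + 1) = bact (H * ps_z2 (psX A)) g i j.
  rewrite bactM //; apply: eq_nsum => b; apply: eq_nsum => a.
  by rewrite z2g [j + 1 + _]addrAC.
rewrite shift1 shift2 -bactBl //.
set D := ps_z1 (psX A) - ps_z2 (psX A).
have Dg i j : bact D g i j = mode_diff g i j by rewrite bactBl // z1g z2g.
(* Raising k multiplies by t(z) = z u(z), and raising l by t(w) = w u(w); the difference is the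
   difference quotient times z - w. *)
transitivity (bact (ps_z1 (kser γ k) * ps_z2 (kser γ l) * (F * diff_quot (ps_expquo γ)) * D) g k l).
  congr (bact _ g k l); rewrite -!mulrA -diff_quotE !kserS.
  have z1M f h : ps_z1 (f * h) = ps_z1 f * ps_z1 h := psCM f h.
  rewrite !z1M !ps_z2M; ring.
by rewrite bactM //; apply: eq_nsum => b; apply: eq_nsum => a; rewrite Dg.
Qed.

(** The inner mode vanishes for j at least J, and each of the finitely many j from n to J - 1 has
    its own bound on i. *)
Let boxed12 x y v : boxed (fun i j => mode i x (mode j y v)).
Proof.
move=> n; have [J yJ] := mode_trunc modeP y v.
have [I xI] : exists I : int, forall i j, n <= j -> j < J -> I <= i -> mode i x (mode j y v) = 0.
  have [k] : exists k : nat, J <= n + k%:Z by exists (absz (J - n)); lia.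
  elim: k J {yJ} => [|k IH] J leJ; first by exists 0 => *; lia.
  have [|I xI] := IH (J - 1); first lia.
  have [I' xI'] := mode_trunc modeP x (mode (J - 1) y v).
  exists (`|I| + `|I'|) => i j len ltj leI.
  have [->|ne] := eqVneq j (J - 1); first by apply: xI'; lia.
  by apply: xI; lia.
exists (`|I| + `|J|) => i j len1 len2 leB.
have [ltj|lej] := ltrP j J; last by rewrite yJ ?mode0.
by apply: xI => //; lia.
Qed.

Let boxed21 x y v : boxed (fun i j => mode j y (mode i x v)).
Proof.
by move=> n; have [B g0] := boxed12 y x v n; exists B => i j ? ? ?; apply: g0; lia.
Qed.

(** The supercommutator in the new coordinate is [coord_bact] of the old one with F = 1, and
    [iter_coord_bact] exhibits (z - w)^M as a factor. *)
Let coord_local p q x y : hom p x -> hom q y -> exists M : nat, forall v i j,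
  iter M (@mode_diff _) (fun i j => coord_mode i x (coord_mode j y v)
    - (-1) ^+ (p * q) *: coord_mode j y (coord_mode i x v)) i j = 0.
Proof.
move=> hx hy; have [M xy] := mode_local modeP hx hy; exists M => v i j.
set g := fun i j => mode i x (mode j y v) - (-1) ^+ (p * q) *: mode j y (mode i x v).
have gb : boxed g by apply: boxedB; [exact: boxed12|exact: boxed21].
rewrite [X in iter M _ X](_ : _ = fun k l => coord_bact g k l 1).
  rewrite iter_coord_bact //; apply: nsum0 => b; apply: nsum0 => a.
  by rewrite xy scaler0.
apply/funext => {}i; apply/funext => {}j; rewrite /coord_bact mulr1 bactB //.
congr (_ - _ *: _).
  have [B g0] := boxed_at i j (boxed12 x y v).
  have [B' yB] := mode_bound y v j.
  rewrite (@bactE _ _ (B + B')) => [|a b leB]; last by apply: g0; lia.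
  (* [bact] sums over the index of w on the outside, whereas here the outer mode is that of x; in
     the opposite ordering the sums already match. *)
  rewrite exchange_big /= /coord_mode [in LHS](@nsumE _ (B + B')) => [|a leB]; last first.
    rewrite (linear_nsum (mode_linr modeP _ _)) // nsum0 ?scaler0 // => b.
    by rewrite (linfunZ (mode_linr modeP _ _)) g0 ?scaler0 //; lia.
  apply: eq_bigr => a _; rewrite (@nsumE _ (B + B')) => [|b leB]; last first.
    by rewrite yB ?scaler0 //; lia.
  rewrite (big_morph _ (linfunD (mode_linr modeP _ _)) (mode0 _ _)) scaler_sumr.
  by apply: eq_bigr => b _; rewrite (linfunZ (mode_linr modeP _ _)) scalerA ps_tensE.
have [B g0] := boxed_at i j (boxed21 x y v).
have [B' xB] := mode_bound x v i.
rewrite (@bactE _ _ (B + B')) => [|a b leB]; last by apply: g0; lia.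
rewrite /coord_mode [in LHS](@nsumE _ (B + B')) => [|b leB]; last first.
  rewrite (linear_nsum (mode_linr modeP _ _)) // nsum0 ?scaler0 // => a.
  by rewrite (linfunZ (mode_linr modeP _ _)) g0 ?scaler0 //; lia.
apply: eq_bigr => b _; rewrite (@nsumE _ (B + B')) => [|a leB]; last first.
  by rewrite xB ?scaler0 //; lia.
rewrite (big_morph _ (linfunD (mode_linr modeP _ _)) (mode0 _ _)) scaler_sumr.
by apply: eq_bigr => a _; rewrite (linfunZ (mode_linr modeP _ _)) scalerA ps_tensE mulrC.
Qed.

Theorem coord_mode_algebra : is_mode_algebra γ hom coord_mode one T.
Proof.
split=> //.
- exact: transl_lin modeP.
- exact: transl1 modeP.
- exact: mode_grading modeP.
- exact: transl_hom modeP.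
Qed.

End CoordinateChange.

(** * Extension of scalars to C[γ] *)

Lemma lspan_ind (A : pzRingType) (W : lmodType A) (S : set W) (P : W -> Prop) :
  P 0 -> (forall c x y, P x -> P y -> P (c *: x + y)) -> (forall s, S s -> P s) ->
  forall x, x \in lspan S -> P x.
Proof.
move=> P0 PL PS x /asboolP[n [c [s [Ss ->]]]].
apply: (big_ind P) => // [u v Pu Pv|i _]; first by rewrite -[u]scale1r; apply: PL.
by rewrite -[X in P X]addr0; apply: PL => //; apply: PS.
Qed.

Lemma mem_lspan (A : pzRingType) (W : lmodType A) (S : set W) s : S s -> s \in lspan S.
Proof.
move=> Ss; apply/asboolP; exists 1%N, (fun=> 1), (fun=> s); split=> //.
by rewrite big_ord1 scale1r.
Qed.

Section ScalarExtension.
Variables (K : fieldType) (γ : gamma_param K).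

Definition gamma_const : K -> gamma_ring γ :=
  match γ return K -> gamma_ring γ with GammaNumber _ => id | GammaFormal => polyC end.

Lemma gamma_const_int (m : int) : gamma_const m%:~R = m%:~R.
Proof. by rewrite /gamma_const; case: γ => // ; rewrite rmorph_int. Qed.

Lemma gamma_const_sign n : gamma_const ((-1) ^+ n) = (-1) ^+ n.
Proof. by rewrite /gamma_const; case: γ => // ; rewrite rmorphXn /= rmorphN1. Qed.

(** Linearity over the base field of a map into a module over the larger ring; [linear] requires one
    ring on both sides. *)
Definition gamma_linear (V : lmodType K) (U : lmodType (gamma_ring γ)) (g : V -> U) :=
  forall c u v, g (c *: u + v) = gamma_const c *: g u + g v.

(** The universal property of V[γ]: the extension of a map defined on V to a map linear over the
    larger ring. *)
Definition gamma_ext (V : lmodType K) :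
    forall U : lmodType (gamma_ring γ), (V -> U) -> gamma_mod V γ -> U :=
  match γ return forall U : lmodType (gamma_ring γ), (V -> U) -> gamma_mod V γ -> U with
  | GammaNumber _ => fun U g => g
  | GammaFormal => fun U g v => nsum (fun n => 'X^n *: g (vcoef v n))
  end.
End ScalarExtension.

Section FormalExtension.
Variables (K : fieldType) (V : lmodType K) (U : lmodType {poly K}) (g : V -> U).
Hypothesis gL : forall c u v, g (c *: u + v) = c%:P *: g u + g v.

Local Notation ext := (fun v : vpoly V => nsum (fun n => 'X^n *: g (vcoef v n))).

Let g0 : g 0 = 0.
Proof. by have := gL (-1) 0 0; rewrite polyCN scaler0 addr0 scaleN1r addNr. Qed.

Let extfin (v : vpoly V) : ultimately0 (fun n => 'X^n *: g (vcoef v n)).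
Proof.
by case: v => v /= /asboolP[B v0]; exists B => i /v0 ->; rewrite g0 scaler0.
Qed.

Lemma formal_ext_linear : linear ext.
Proof.
have extD (v w : vpoly V) : ext (v + w) = ext v + ext w.
  rewrite -nsumD //; apply: eq_nsum => n; rewrite vcoefD -scalerDr.
  by have := gL 1 (v n) (w n); rewrite polyC1 !scale1r => ->.
suff extZ p v : ext (p *: v) = p *: ext v by move=> p v w; rewrite extD extZ.
(* It suffices to treat multiplication by 'X, which shifts coefficients, and by constants. *)
elim/poly_ind: p v => [|p c IH] v.
  by rewrite !scale0r nsum0 // => i; rewrite g0 scaler0.
rewrite !scalerDl extD -!scalerA IH; congr (_ *: _ + _).
  rewrite nsum_recl // /= /vpoly_scale_coef big_ord1 coefX /= scale0r g0 scaler0 add0r.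
  rewrite (linear_nsum (scale_linear _)) //; apply: eq_nsum => n.
  rewrite exprS scalerA /vpoly_scale_coef big_ord_recl coefX scale0r add0r.
  rewrite big_ord_recl coefX /= scale1r subSS subn0 big1 ?addr0 // => i _.
  by rewrite coefX scale0r.
rewrite (linear_nsum (scale_linear _)) //; apply: eq_nsum => n.
rewrite /= /vpoly_scale_coef big_ord_recl coefC /= subn0 big1 => [|i _]; last by rewrite coefC scale0r.
by rewrite gL g0 addr0 !scalerA mulrC.
Qed.

Lemma formal_ext_in v : nsum (fun n => 'X^n *: g (vcoef (vconst v) n)) = g v.
Proof.
rewrite (@nsumE _ 1) => [|i i0]; last by rewrite /= eqn0Ngt i0 g0 scaler0.
by rewrite big_ord1 expr0 scale1r.
Qed.

(** Horner's scheme: an element is 'X times its shift plus its constant term, and the shift has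
    smaller support. *)
Lemma vpoly_ind (P : vpoly V -> Prop) : (forall v, P (vconst v)) ->
  (forall c x y, P x -> P y -> P (c *: x + y)) -> forall w, P w.
Proof.
move=> Pin PL [w wfin]; have /asboolP[n w0] := wfin.
have P0 : P 0.
  have -> : 0 = vconst 0 :> vpoly V by apply: vpoly_ext => -[].
  exact: Pin.
elim: n w wfin w0 => [|n IH] w wfin w0.
  by have -> : VPoly wfin = 0 by apply: vpoly_ext => i /=; rewrite w0.
have sfin : (fun i => w i.+1) \in @finsupp_seq K V.
  by apply/asboolP; exists n => i lei; apply: w0.
have -> : VPoly wfin = 'X *: VPoly sfin + vconst (w 0%N).
  apply: vpoly_ext => i; rewrite vcoefD /= /vpoly_scale_coef.
  case: i => [|i] /=; first by rewrite big_ord1 coefX scale0r add0r.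
  rewrite big_ord_recl coefX scale0r add0r big_ord_recl coefX /= scale1r.
  rewrite big1 ?addr0 ?subSS ?subn0 // => j _; by rewrite coefX scale0r.
by apply: PL => //; apply: IH => i lei; apply: w0.
Qed.
End FormalExtension.

Section GammaMod.
Variables (K : fieldType) (V : lmodType K) (γ : gamma_param K).

Lemma gamma_in_semilinear : gamma_linear (@gamma_in K V γ).
Proof.
case: γ => [c|] // c u v; apply: vpoly_ext => n.
rewrite vcoefD /= /vpoly_scale_coef big_ord_recl coefC big1 /= => [|i _]; last first.
  by rewrite coefC scale0r.
by rewrite addr0 subn0; case: eqP => // _; rewrite scaler0 addr0.
Qed.

Lemma gamma_extL (U : lmodType (gamma_ring γ)) (g : V -> U) :
  gamma_linear g -> linear (gamma_ext g).
Proof. by case: γ U g => [c|] U g gL //; exact: formal_ext_linear. Qed.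

Lemma gamma_ext_in (U : lmodType (gamma_ring γ)) (g : V -> U) v :
  gamma_linear g -> gamma_ext g (gamma_in γ v) = g v.
Proof. by case: γ U g => [c|] U g gL //; exact: formal_ext_in. Qed.

Lemma gamma_ind (P : gamma_mod V γ -> Prop) : (forall v, P (gamma_in γ v)) ->
  (forall c x y, P x -> P y -> P (c *: x + y)) -> forall w, P w.
Proof. by case: γ P => [c|] P; [move=> Pin _ | exact: vpoly_ind]. Qed.

Lemma gamma_in0 : gamma_in γ 0 = 0 :> gamma_mod V γ.
Proof.
have := gamma_in_semilinear (-1) 0 0.
have -> : gamma_const γ (-1) = -1 by have := gamma_const_sign γ 1; rewrite !expr1.
by rewrite scaler0 addr0 scaleN1r addNr.
Qed.

Lemma gamma_inD (u v : V) : gamma_in γ (u + v) = gamma_in γ u + gamma_in γ v.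
Proof.
have := gamma_in_semilinear 1 u v; rewrite !scale1r => ->.
by have -> : gamma_const γ 1 = 1 := gamma_const_int γ 1; rewrite scale1r.
Qed.

Lemma gamma_inZ c (v : V) : gamma_in γ (c *: v) = gamma_const γ c *: gamma_in γ v.
Proof. by have := gamma_in_semilinear c v 0; rewrite gamma_in0 !addr0. Qed.

Lemma gamma_inB (u v : V) : gamma_in γ (u - v) = gamma_in γ u - gamma_in γ v.
Proof.
have := gamma_inD (u - v) v; rewrite subrK => ->; rewrite addrK //.
Qed.

End GammaMod.

(** The projection onto the even part extends to V[γ], which is how the even and odd parts there are
    shown to meet in zero. *)
Lemma grading_projection (K : pzRingType) (V : lmodType K) (hom : bool -> set V) :
  is_grading hom -> exists π : V -> V, [/\ linear π,
    forall v, hom false v -> π v = v & forall v, hom true v -> π v = 0].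
Proof.
case=> h0 hL hdec hint.
have hB p u v : hom p u -> hom p v -> hom p (u - v).
  by move=> hu hv; rewrite -scaleN1r addrC; apply: hL.
have /choice[π πP] v : exists w, hom false w /\ hom true (v - w).
  by have [v0 [v1 [hv0 hv1 ->]]] := hdec v; exists v0; rewrite addrC addKr.
have πE v w : hom false w -> hom true (v - w) -> π v = w.
  move=> hw hvw; have [hπ hvπ] := πP v.
  apply/eqP; rewrite -subr_eq0; apply/eqP; apply: hint; first exact: hB.
  have -> : π v - w = (v - w) - (v - π v) by rewrite opprB [RHS]addrC subrKA.
  exact: hB.
exists π; split=> [c u v|v hv|v hv]; apply: πE; rewrite ?subrr ?subr0 //.
- by apply: hL; have [] := πP u; have [] := πP v.
- rewrite opprD addrACA -scalerBr; apply: hL; [by have [] := πP u|by have [] := πP v].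
Qed.

(** * The modes of V extended bilinearly to V[γ] *)

Section ExtendedModes.
Variables (K : fieldType) (V : vertex_superalgebra K) (γ : gamma_param K).
Local Notation W := (gamma_mod V γ).
Local Notation into := (@gamma_in K V γ).

Definition gamma_hom (p : bool) (w : W) : Prop :=
  w \in lspan [set y | exists2 v : V, Defs.hom p v & y = into v].

(** The extension is made one argument at a time, the second one first. The index -1 - n converts a
    mode number into an exponent of z. *)
Let inner (n : int) (a : V) : W -> W := gamma_ext (fun b : V => into (va_Y a (-1 - n) b)).

Definition gamma_mode (n : int) (x y : W) : W := gamma_ext (fun a => inner n a y) x.

Definition gamma_transl : W -> W := gamma_ext (fun a => into (va_T a)).

Let innerL n a : linear (inner n a).
Proof.
apply: gamma_extL => c u v; rewrite va_Y_linearr.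
exact: gamma_in_semilinear.
Qed.

Let inner_in n a b : inner n a (into b) = into (va_Y a (-1 - n) b).
Proof.
rewrite /inner gamma_ext_in // => c u v; rewrite va_Y_linearr.
exact: gamma_in_semilinear.
Qed.

Let inner_semilinear n y : gamma_linear (fun a => inner n a y).
Proof.
move=> c a a'; elim/gamma_ind: y => [b|d x y IHx IHy].
  by rewrite !inner_in (linfunD (va_Y_linearl _ _)) (linfunZ (va_Y_linearl _ _)) gamma_inD gamma_inZ.
by rewrite !innerL IHx IHy !scalerDr !scalerA mulrC addrACA.
Qed.

Lemma gamma_mode_linl n y : linear (fun x => gamma_mode n x y).
Proof. exact/gamma_extL/inner_semilinear. Qed.

Lemma gamma_mode_linr n x : linear (gamma_mode n x).
Proof.
move=> c u v; elim/gamma_ind: x => [a|d x y IHx IHy].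
  by rewrite /gamma_mode !gamma_ext_in ?innerL //; exact: inner_semilinear.
by rewrite !gamma_mode_linl IHx IHy !scalerDr !scalerA mulrC addrACA.
Qed.

Lemma gamma_mode_in n a b : gamma_mode n (into a) (into b) = into (va_Y a (-1 - n) b).
Proof. by rewrite /gamma_mode gamma_ext_in ?inner_in //; exact: inner_semilinear. Qed.

Let va_T_semilinear : gamma_linear (fun a : V => into (va_T a)).
Proof. by move=> c u v; rewrite va_T_linear; exact: gamma_in_semilinear. Qed.

Lemma gamma_transl_linear : linear gamma_transl.
Proof. exact: gamma_extL. Qed.

Lemma gamma_transl_in a : gamma_transl (into a) = into (va_T a).
Proof. exact: gamma_ext_in. Qed.

Lemma gamma_hom_in p a : Defs.hom p a -> gamma_hom p (into a).
Proof. by move=> ha; apply: mem_lspan; exists a. Qed.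

Lemma gamma_hom0 p : gamma_hom p 0.
Proof. exact: rpred0. Qed.

Lemma gamma_homL p c u v : gamma_hom p u -> gamma_hom p v -> gamma_hom p (c *: u + v).
Proof. by move=> hu hv; apply: rpredD => //; apply: rpredZ. Qed.

Lemma gamma_hom_ind p (P : W -> Prop) : P 0 ->
  (forall c x y, P x -> P y -> P (c *: x + y)) -> (forall a, Defs.hom p a -> P (into a)) ->
  forall x, gamma_hom p x -> P x.
Proof. by move=> P0 PL Pin; apply: lspan_ind => // s [a ha ->]; apply: Pin. Qed.

Lemma gamma_grading : is_grading gamma_hom.
Proof.
have grV : is_grading (@Defs.hom K V) by case: (va_space V).
split=> [p|p c u v|w|w w0 w1].
- exact: gamma_hom0.
- exact: gamma_homL.
- elim/gamma_ind: w => [a|c x y [x0 [x1 [hx0 hx1 ->]]] [y0 [y1 [hy0 hy1 ->]]]].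
    have [_ _ /(_ a)[a0 [a1 [h0 h1 ->]]] _] := grV.
    by exists (into a0), (into a1); rewrite gamma_inD; split=> //; exact: gamma_hom_in.
  exists (c *: x0 + y0), (c *: x1 + y1); rewrite scalerDr addrACA.
  by split=> //; exact: gamma_homL.
have [π [πL π0 π1]] := grading_projection grV.
have πsL : gamma_linear (fun a => into (π a)).
  by move=> c u v; rewrite πL; exact: gamma_in_semilinear.
(* The extended projection fixes even elements and kills odd ones. *)
pose Π := gamma_ext (fun a => into (π a)).
have ΠL : linear Π by exact: gamma_extL.
have Π0 : Π w = w.
  elim/gamma_hom_ind: w0 {w1} => [|c x y ex ey|a ha].
  - exact: linfun0 ΠL.
  - by rewrite ΠL ex ey.
  - by rewrite /Π gamma_ext_in // π0.
rewrite -Π0; elim/gamma_hom_ind: w1 {w0 Π0} => [|c x y ex ey|a ha].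
- exact: linfun0 ΠL.
- by rewrite ΠL ex ey scaler0 addr0.
- by rewrite /Π gamma_ext_in // π1 // gamma_in0.
Qed.

Lemma gamma_mode_hom p q x y n :
  gamma_hom p x -> gamma_hom q y -> gamma_hom (p (+) q) (gamma_mode n x y).
Proof.
move=> hx hy; elim/gamma_hom_ind: hx => [|c u v hu hv|a ha].
- by rewrite (linfun0 (gamma_mode_linl _ _)); exact: gamma_hom0.
- by rewrite gamma_mode_linl; exact: gamma_homL.
elim/gamma_hom_ind: hy => [|c u v hu hv|b hb].
- by rewrite (linfun0 (gamma_mode_linr _ _)); exact: gamma_hom0.
- by rewrite gamma_mode_linr; exact: gamma_homL.
by rewrite gamma_mode_in; apply/gamma_hom_in/va_Y_even.
Qed.

Lemma gamma_transl_comm n x y :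
  gamma_transl (gamma_mode n x y) - gamma_mode n x (gamma_transl y) =
  - (n%:~R *: gamma_mode (n - 1) x y).
Proof.
elim/gamma_ind: x => [a|c x x' IH IH']; last first.
  rewrite !gamma_mode_linl gamma_transl_linear opprD addrACA -scalerBr IH IH'.
  by rewrite scalerDr opprD scalerN !scalerA mulrC.
elim/gamma_ind: y => [b|c y y' IH IH']; last first.
  rewrite !gamma_transl_linear !gamma_mode_linr gamma_transl_linear opprD addrACA -scalerBr IH IH'.
  by rewrite scalerDr opprD scalerN !scalerA mulrC.
rewrite gamma_transl_in !gamma_mode_in gamma_transl_in -gamma_inB va_T_comm gamma_inZ.
rewrite gamma_const_int -scaleNr -mulrNz; congr (_%:~R *: into (va_Y _ _ _)); lia.
Qed.

Lemma gamma_mode_trunc x y : exists n0 : int, forall n, n0 <= n -> gamma_mode n x y = 0.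
Proof.
elim/gamma_ind: x => [a|c x x' [n0 xn] [n0' xn']]; last first.
  exists (`|n0| + `|n0'|) => n len.
  by rewrite gamma_mode_linl xn ?xn' ?scaler0 ?addr0 //; lia.
elim/gamma_ind: y => [b|c y y' [n0 yn] [n0' yn']]; last first.
  exists (`|n0| + `|n0'|) => n len.
  by rewrite gamma_mode_linr yn ?yn' ?scaler0 ?addr0 //; lia.
have [M YM] := va_Y_laurent a b; exists (- M) => n len.
by rewrite gamma_mode_in YM ?gamma_in0 //; lia.
Qed.

Lemma iter_zw_mul (U : zmodType) M (g : int -> int -> U) i j :
  iter M (@zw_mul U) g (-1 - i) (-1 - j) =
  iter M (@mode_diff U) (fun i j => g (-1 - i) (-1 - j)) i j.
Proof.
elim: M i j => //= M IH i j; rewrite /mode_diff -!IH /zw_mul.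
by rewrite !opprD !addrA.
Qed.

(** Locality passes from vectors of V to combinations: in x and in y by taking the maximum of two
    orders, in v with the same order, which is uniform in v. *)
Lemma gamma_mode_local p q x y : gamma_hom p x -> gamma_hom q y -> exists M : nat,
  forall v i j, iter M (@mode_diff _) (fun i j => gamma_mode i x (gamma_mode j y v)
    - (-1) ^+ (p * q) *: gamma_mode j y (gamma_mode i x v)) i j = 0.
Proof.
move=> hx hy; pose E x y v i j := gamma_mode i x (gamma_mode j y v)
    - (-1) ^+ (p * q) *: gamma_mode j y (gamma_mode i x v).
have EL c u u' v i j w : E (c *: u + u') v w i j = c *: E u v w i j + E u' v w i j.
  rewrite /E !gamma_mode_linl gamma_mode_linr !scalerDr scalerN opprD addrACA.
  by rewrite !scalerA mulrC.
have ER c u u' v i j w : E v (c *: u + u') w i j = c *: E v u w i j + E v u' w i j.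
  rewrite /E !gamma_mode_linl gamma_mode_linr !scalerDr scalerN opprD addrACA.
  by rewrite !scalerA mulrC.
have EV c u u' v v' i j : E v v' (c *: u + u') i j = c *: E v v' u i j + E v v' u' i j.
  rewrite /E !gamma_mode_linr !scalerDr scalerN opprD addrACA.
  by rewrite !scalerA mulrC.
have comb (f g h : int -> int -> W) c M M' : (forall i j, f i j = c *: g i j + h i j) ->
    (forall i j, iter M (@mode_diff _) g i j = 0) ->
    (forall i j, iter M' (@mode_diff _) h i j = 0) ->
    forall i j, iter (maxn M M') (@mode_diff _) f i j = 0.
  move=> fgh g0 h0 i j.
  have -> : f = fun i j => c *: g i j + h i j by apply/funext => a; apply/funext => b.
  rewrite iter_mode_diffD -(linear_iter_mode_diff _ _ _ _ (scale_linear c)).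
  rewrite (iter_mode_diff_le (leq_maxl M M') g0) (iter_mode_diff_le (leq_maxr M M') h0).
  by rewrite scaler0 addr0.
suff: exists M : nat, forall v i j, iter M (@mode_diff _) (E x y v) i j = 0 by [].
have E0 (f : int -> int -> W) : (forall i j, f i j = 0) ->
    forall i j, iter 0 (@mode_diff _) f i j = 0 by [].
elim/gamma_hom_ind: hx => [|c u u' [M uM] [M' uM']|a ha].
- exists 0%N => v; apply: E0 => i j.
  by rewrite /E !(linfun0 (gamma_mode_linl _ _)) (linfun0 (gamma_mode_linr _ _)) scaler0 subrr.
- by exists (maxn M M') => v; apply: comb => // i j; exact: EL.
elim/gamma_hom_ind: hy => [|c u u' [M uM] [M' uM']|b hb].
- exists 0%N => v; apply: E0 => i j.
  by rewrite /E !(linfun0 (gamma_mode_linl _ _)) (linfun0 (gamma_mode_linr _ _)) scaler0 subrr.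
- by exists (maxn M M') => v; apply: comb => // i j; exact: ER.
have [M loc] := va_locality ha hb; exists M.
elim/gamma_ind => [v|c u u' uM uM'] i j; last first.
  by have := comb _ _ _ c M M (fun i j => EV c u u' _ _ i j) uM uM' i j; rewrite maxnn.
have := congr1 into (loc v (-1 - i) (-1 - j)); rewrite gamma_in0 iter_zw_mul => <-.
rewrite (additive_iter_mode_diff _ _ _ _ (@gamma_inB _ _ _)); congr (iter _ _ _ _ _).
apply/funext => k; apply/funext => l.
by rewrite /E !gamma_mode_in gamma_inB gamma_inZ gamma_const_sign.
Qed.

(** The scalars contain γ, but the coordinate is still z, so the translation parameter is 0. *)
Theorem gamma_mode_algebra :
  is_mode_algebra 0 gamma_hom gamma_mode (into (va_one V)) gamma_transl.
Proof.
split.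
- exact: gamma_mode_linl.
- exact: gamma_mode_linr.
- exact: gamma_mode_trunc.
- move=> n; elim/gamma_ind => [b|c x y IHx IHy].
    rewrite gamma_mode_in va_Y_one; have -> : (-1 - n == 0) = (n == -1) by lia.
    by case: eqP; rewrite ?gamma_in0.
  by rewrite gamma_mode_linr IHx IHy; case: eqP; rewrite ?scaler0 ?addr0.
- move=> n x n0; elim/gamma_ind: x => [a|c x y IHx IHy].
    by rewrite gamma_mode_in va_creation_reg ?gamma_in0 //; lia.
  by rewrite gamma_mode_linl IHx IHy scaler0 addr0.
- elim/gamma_ind => [a|c x y IHx IHy]; first by rewrite gamma_mode_in subrr va_creation.
  by rewrite gamma_mode_linl IHx IHy.
- exact: gamma_transl_linear.
- by rewrite gamma_transl_in va_T_one gamma_in0.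
- by move=> n x y; rewrite gamma_transl_comm mul0r scale0r subr0.
- exact: gamma_grading.
- exact: gamma_mode_hom.
- move=> p x hx; elim/gamma_hom_ind: hx => [|c u v hu hv|a ha].
  + by rewrite (linfun0 gamma_transl_linear); exact: gamma_hom0.
  + by rewrite gamma_transl_linear; exact: gamma_homL.
  + by rewrite gamma_transl_in; apply/gamma_hom_in/va_T_even.
- exact: gamma_mode_local.
Qed.

End ExtendedModes.

(** * The Zhu algebra *)

Section ZhuIdeal.
Variables (A : comUnitRingType) (W : lmodType A) (γ : A) (hom : bool -> W -> Prop).
Variables (mode : int -> W -> W -> W) (one : W) (T : W -> W).
Hypothesis modeP : is_mode_algebra γ hom mode one T.
Hypothesis natU : forall n, n.+1%:R \is a @GRing.unit A.

Definition zhu_ideal : submodClosed W := lspan [set w | exists x y, w = mode (-2%:Z) x y].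

Let modeL n x : linear (mode n x) := mode_linr modeP n x.

(** [mode_transl] expresses (k + 2) x_(-k-3) y through (Tx)_(-k-2) y and x_(-k-2) y, and k + 2 is
    invertible. *)
Lemma zhu_ideal_mode k x y : mode (- k.+2%:Z) x y \in zhu_ideal.
Proof.
elim: k x => [|k IH] x; first by apply: mem_lspan; exists x, y.
have := mode_transl modeP natU (- k.+2%:Z) x y.
rewrite -scaleNr -mulrNz opprK => e.
have -> : - k.+3%:Z = - k.+2%:Z - 1 by lia.
rewrite -[mode _ _ _]scale1r -(mulVr (natU k.+1)) -scalerA; apply: rpredZ.
have -> : k.+2%:R *: mode (- k.+2%:Z - 1) x y = mode (- k.+2%:Z) (T x) y
    + (γ * (- k.+2%:Z + 1)%:~R) *: mode (- k.+2%:Z) x y by rewrite e subrK.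
by apply: rpredD => //; apply: rpredZ.
Qed.

Lemma zhu_ideal_nsum x (g : nat -> W) m : (2 <= m)%N ->
  ultimately0 (fun i : nat => mode (- m%:Z - i%:Z) x (g i)) ->
  nsum (fun i : nat => mode (- m%:Z - i%:Z) x (g i)) \in zhu_ideal.
Proof.
move=> m2; apply: (nsum_closed (P := fun w => w \in zhu_ideal)) => [|u v|i].
- exact: rpred0.
- exact: rpredD.
- have -> : - m%:Z - i%:Z = - (m - 2 + i).+2%:Z by lia.
  exact: zhu_ideal_mode.
Qed.

Let bilinear_ind (P : W -> W -> Prop) :
  (forall x x' y, P x y -> P x' y -> P (x + x') y) ->
  (forall x y y', P x y -> P x y' -> P x (y + y')) ->
  (forall p q x y, hom p x -> hom q y -> P x y) -> forall x y, P x y.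
Proof.
move=> Pl Pr Phom x y; have [_ _ hdec _] := mode_grading modeP.
have [x0 [x1 [hx0 hx1 ->]]] := hdec x; have [y0 [y1 [hy0 hy1 ->]]] := hdec y.
by apply: Pl; apply: Pr; apply: Phom; eassumption.
Qed.

(** In the expansion of [mode_mode_m1], the term i = 0 of the first sum is x_(-1) (y_(-n) z). Every
    other term begins with a mode of index at most -2, in the second sum because n >= 1. *)
Let zhu_normal_order p q x y z n : hom p x -> hom q y -> (1 <= n)%N ->
  mode (- n%:Z) (mode (-1) x y) z - mode (-1) x (mode (- n%:Z) y z) \in zhu_ideal.
Proof.
move=> hx hy n1; rewrite (mode_mode_m1 modeP natU _ _ hx hy) /normal_order.
have fin k m : ultimately0 (fun i : nat => mode (k - i%:Z) x (mode (m + i%:Z) y z)).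
  have [B y0] := mode_fin modeP y m z; exists B => i /y0 ->; exact: linfun0 (modeL _ _).
have fin' k : ultimately0 (fun i : nat => mode (k - i%:Z) y (mode i%:Z x z)).
  have [B x0] := mode_fin modeP x 0 z; exists B => i /x0; rewrite add0r => ->.
  exact: linfun0 (modeL _ _).
rewrite nsum_recl // addr0 subr0 -!addrA [X in _ + X]addrA addrC subrK; apply: rpredD.
  rewrite (_ : (fun i : nat => _) = fun i : nat =>
      mode (- 2%:Z - i%:Z) x (mode (- n%:Z + i.+1%:Z) y z)).
    apply: zhu_ideal_nsum => //; have [B g0] := fin (-1) (- n%:Z).
    by exists B => i lei; have := g0 i.+1 (leqW lei); congr (mode _ _ _ = _); lia.
  by apply/funext => i; congr (mode _ _ _); lia.
apply: rpredZ.
have -> : - n%:Z - 1 = - n.+1%:Z by lia.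
exact: zhu_ideal_nsum.
Qed.

Lemma zhu_mulA x y z :
  mode (-1) (mode (-1) x y) z - mode (-1) x (mode (-1) y z) \in zhu_ideal.
Proof.
move: x y; apply: bilinear_ind => [x x' y e e'|x y y' e e'|p q x y hx hy].
- rewrite !(linfunD (mode_linl modeP _ _)) opprD addrACA; exact: rpredD.
- rewrite (linfunD (modeL _ _)) !(linfunD (mode_linl modeP _ _)) (linfunD (modeL _ _)).
  by rewrite opprD addrACA; exact: rpredD.
- exact: (zhu_normal_order (n := 1) z hx hy).
Qed.

(** For a generator y_(-2) z, the element x_(-1) (y_(-2) z) agrees modulo the ideal with (x_(-1)
    y)_(-2) z, which lies in it. *)
Lemma zhu_ideal_mull x y : y \in zhu_ideal -> mode (-1) x y \in zhu_ideal.
Proof.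
move: y; apply: lspan_ind => [|c y y' hy hy'|_ [y [z ->]]].
- by rewrite (linfun0 (modeL _ _)); exact: rpred0.
- by rewrite modeL; apply: rpredD => //; apply: rpredZ.
move: x y; apply: bilinear_ind => [x x' y e e'|x y y' e e'|p q x y hx hy].
- by rewrite (linfunD (mode_linl modeP _ _)); exact: rpredD.
- by rewrite (linfunD (mode_linl modeP _ _)) (linfunD (modeL _ _)); exact: rpredD.
- rewrite -[mode (-1) x _](subKr (mode (-2%:Z) (mode (-1) x y) z)).
  apply: rpredB; first exact: (zhu_ideal_mode 0).
  exact: (zhu_normal_order (n := 2) z hx hy).
Qed.

Lemma zhu_ideal_mulr x y : x \in zhu_ideal -> mode (-1) x y \in zhu_ideal.
Proof.
move: x; apply: lspan_ind => [|c x x' hx hx'|_ [x [z ->]]].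
- by rewrite (linfun0 (mode_linl modeP _ _)); exact: rpred0.
- by rewrite (mode_linl modeP); apply: rpredD => //; apply: rpredZ.
(* At index -1 the γ-term of [mode_transl] has the factor n + 1 = 0. Associativity then turns
   (x_(-2) z)_(-1) y into x_(-2) (z_(-1) y). *)
have TE u : mode (-1) (T x) u = mode (-2%:Z) x u.
  by rewrite (mode_transl modeP natU) mulr0 scale0r subr0 mulrNz scaleN1r opprK.
rewrite -TE; have := zhu_mulA (T x) z y; rewrite [X in _ - X]TE => e.
rewrite -[X in X \in _](subrK (mode (-2%:Z) x (mode (-1) z y))); apply: rpredD => //.
exact: (zhu_ideal_mode 0).
Qed.

(** The ideal is spanned by the x_(-2) y with x and y homogeneous. This is what lets the parity
    decomposition descend to the quotient. *)
Lemma zhu_ideal_graded x : x \in zhu_ideal -> exists x0 x1,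
  [/\ x0 \in zhu_ideal, x1 \in zhu_ideal, hom false x0, hom true x1 & x = x0 + x1].
Proof.
have [h0 hL hdec _] := mode_grading modeP.
have hD p u v : hom p u -> hom p v -> hom p (u + v).
  by move=> hu hv; rewrite -[u]scale1r; apply: hL.
move: x; apply: lspan_ind => [|c x y [x0 [x1 [ox0 ox1 hx0 hx1 ->]]] [y0 [y1 [oy0 oy1 hy0 hy1 ->]]]|s].
- by exists 0, 0; split; rewrite ?rpred0 ?addr0.
- exists (c *: x0 + y0), (c *: x1 + y1); rewrite scalerDr addrACA.
  by split; rewrite ?rpredD ?rpredZ //; apply: hL.
move=> [x [y ->]]; move: x y; apply: bilinear_ind.
- move=> x x' y [x0 [x1 [ox0 ox1 hx0 hx1 e]]] [y0 [y1 [oy0 oy1 hy0 hy1 e']]].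
  exists (x0 + y0), (x1 + y1); rewrite (linfunD (mode_linl modeP _ _)) e e' addrACA.
  by split; rewrite ?rpredD //; apply: hD.
- move=> x y y' [x0 [x1 [ox0 ox1 hx0 hx1 e]]] [y0 [y1 [oy0 oy1 hy0 hy1 e']]].
  exists (x0 + y0), (x1 + y1); rewrite (linfunD (modeL _ _)) e e' addrACA.
  by split; rewrite ?rpredD //; apply: hD.
move=> p q x y hx hy; have := mode_hom modeP (-2%:Z) hx hy.
have o := zhu_ideal_mode 0 x y; case: (p (+) q) => h.
  by exists 0, (mode (-2%:Z) x y); split; rewrite ?rpred0 ?add0r.
by exists (mode (-2%:Z) x y), 0; split; rewrite ?rpred0 ?addr0.
Qed.

End ZhuIdeal.

(** * The associative superalgebra structure on the quotient of V[γ] *)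

Section ZhuQuotient.
Variables (K : fieldType) (V : vertex_superalgebra K) (γ : gamma_param K).
Hypothesis charK : forall n, n.+1%:R != 0 :> K.
Local Notation W := (gamma_mod V γ).
Local Notation into := (@gamma_in K V γ).
Local Notation mode := (coord_mode (@gamma_mode K V γ) (gamma_val γ)).

Lemma gamma_natU n : n.+1%:R \is a @GRing.unit (gamma_ring γ).
Proof.
case: γ => [c|] /=; first by rewrite unitfE charK.
by rewrite -polyC_natr rmorph_unit // unitfE charK.
Qed.

Lemma zhu_modeP : is_mode_algebra (gamma_val γ) (@gamma_hom K V γ) mode
  (into (va_one V)) (@gamma_transl K V γ).
Proof. exact: (coord_mode_algebra (gamma_mode_algebra V γ) gamma_natU). Qed.

(** The support of f starts at m and that of v at n0, so the sum over all integers can be counted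
    upwards from m and is finite. *)
Lemma res_z_nsum (A : pzRingType) (U : lmodType A) (f : int -> A) (v : int -> U) (m n0 : int) :
  (forall i, i < m -> f i = 0) -> (forall i, i < n0 -> v i = 0) ->
  res_z f v = nsum (fun i : nat => f (m + i%:Z) *: v (-1 - (m + i%:Z))).
Proof.
move=> f0 v0; pose B := absz (`|m| + `|n0| + 1).
rewrite (@nsumE _ B) => [|i lei]; last by rewrite v0 ?scaler0 //; lia.
rewrite /res_z -(big_mkord xpredT (fun i : nat => f (m + i%:Z) *: v (-1 - (m + i%:Z)))).
rewrite -(big_map (fun i : nat => m + i%:Z) xpredT (fun i => f i *: v (-1 - i))).
rewrite [RHS](@bigfs _ _ _ _ _ predT).
- by apply: eq_fsbigl; apply/seteqP; split.
- by rewrite map_inj_uniq ?iota_uniq // => i j; lia.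
move=> i _ /mapP mi; have [ltm|lem] := ltrP i m; first by rewrite f0 // scale0r.
rewrite [v _]v0 ?scaler0 //; apply/negPn/negP => nlt; apply: mi.
by exists (absz (i - m)); [rewrite mem_index_iota|]; lia.
Qed.

(** With t = (e^(γz) - 1)/γ, the form γ^n e^(γz)/(e^(γz) - 1)^n dz is t^(-n) dt, whose series is
    [kser (-n)]. *)
Lemma va_bulletE n a b : va_bullet γ n a b = mode (- n%:Z) (into a) (into b).
Proof.
have [M YM] := va_Y_laurent a b.
rewrite /va_bullet /gamma_res (@res_z_nsum _ _ _ _ (- n%:Z) M).
- apply: eq_nsum => i; rewrite gamma_mode_in kser_neg /kernel.
  by have -> : - n%:Z + i%:Z + n%:Z = i%:Z by lia.
- move=> i lti; rewrite /kernel; have : i + n%:Z < 0 by lia.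
  by case: (i + _).
- by move=> i lti; rewrite YM ?gamma_in0.
Qed.

(** The generating set may be anything between all a •_2 b and all a •_n b with n >= 2, which covers
    both Zhu algebras. Bilinearity reduces the generators of the ideal, taken from V[γ], to vectors
    of V. *)
Lemma mem_zhu_ideal (S : set W) :
  (forall a b, S (va_bullet γ 2 a b)) ->
  (forall s, S s -> exists k a b, s = va_bullet γ k.+2 a b) ->
  forall w, (w \in lspan S) = (w \in zhu_ideal mode).
Proof.
move=> S2 Sge w; apply/idP/idP.
  move: w; apply: lspan_ind => [|c x y hx hy|s /Sge[k [a [b ->]]]].
  - exact: rpred0.
  - by apply: rpredD => //; apply: rpredZ.
  - by rewrite va_bulletE; exact: (zhu_ideal_mode zhu_modeP gamma_natU).
move: w; apply: lspan_ind => [|c x y hx hy|_ [x [y ->]]].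
- exact: rpred0.
- by apply: rpredD => //; apply: rpredZ.
elim/gamma_ind: x => [a|c x x' IH IH']; last first.
  by rewrite (mode_linl zhu_modeP); apply: rpredD => //; apply: rpredZ.
elim/gamma_ind: y => [b|c y y' IH IH']; last first.
  by rewrite (mode_linr zhu_modeP); apply: rpredD => //; apply: rpredZ.
by rewrite -va_bulletE; apply: mem_lspan.
Qed.

Section Quotient.
Variable S : set W.
Hypothesis S_ideal : forall w, (w \in lspan S) = (w \in zhu_ideal mode).

Let modeL n x : linear (mode n x) := mode_linr zhu_modeP n x.

Definition zhu_mul (x y : quot_span S) : quot_span S := cls S (mode (-1) (repr x) (repr y)).

Let cls_repr (x : quot_span S) : cls S (repr x) = x.
Proof. exact: reprK. Qed.

(** Independence of the chosen representatives, because the ideal is two-sided. *)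
Lemma zhu_mul_cls x y : zhu_mul (cls S x) (cls S y) = cls S (mode (-1) x y).
Proof.
apply/eq_cls; rewrite S_ideal.
have repr_ideal u : repr (cls S u) - u \in zhu_ideal mode.
  by rewrite -S_ideal; apply/eq_cls.
set x' := repr _; set y' := repr _.
have -> : mode (-1) x' y' - mode (-1) x y = mode (-1) (x' - x) y' + mode (-1) x (y' - y).
  by rewrite (linfunB _ _ (mode_linl zhu_modeP _ _)) (linfunB _ _ (modeL _ _)) addrA subrK.
apply: rpredD.
  by apply: (zhu_ideal_mulr zhu_modeP gamma_natU); exact: repr_ideal.
by apply: (zhu_ideal_mull zhu_modeP gamma_natU); exact: repr_ideal.
Qed.

Lemma quot_homP p (x : quot_span S) :
  quot_hom p x <-> exists2 w, gamma_hom p w & x = cls S w.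
Proof.
split=> [|[w hw ->]].
  apply: (lspan_ind (P := fun x => exists2 w, gamma_hom p w & x = cls S w)).
  - by exists 0; [exact: gamma_hom0|rewrite linear0].
  - move=> c _ _ [u hu ->] [v hv ->]; exists (c *: u + v); first exact: gamma_homL.
    by rewrite linearP.
  - by move=> _ [v hv ->]; exists (into v) => //; exact: gamma_hom_in.
elim/gamma_hom_ind: hw => [|c u v hu hv|a ha].
- by rewrite linear0; exact: rpred0.
- by rewrite linearP; apply: rpredD => //; apply: rpredZ.
- by apply: mem_lspan; exists a.
Qed.

Lemma zhu_quotient_superalgebra :
  is_superalgebra (@quot_hom K V γ S) zhu_mul (cls S (into (va_one V))).
Proof.
have [h0 hL hdec hint] := gamma_grading V γ.
have hD p u v : gamma_hom p u -> gamma_hom p v -> gamma_hom p (u + v).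
  by move=> hu hv; apply: rpredD.
split.
- split=> [p|p c x y|x|x].
  + by apply/quot_homP; exists 0; [exact: h0|rewrite linear0].
  + move=> /quot_homP[u hu ->] /quot_homP[v hv ->]; apply/quot_homP.
    by exists (c *: u + v); [exact: hL|rewrite linearP].
  + have [w ->] := clsP x; have [w0 [w1 [hw0 hw1 ->]]] := hdec w.
    exists (cls S w0), (cls S w1); rewrite linearD; split=> //; apply/quot_homP.
      by exists w0.
    by exists w1.
  + move=> /quot_homP[w0 hw0 ->] /quot_homP[w1 hw1] /eq_cls; rewrite S_ideal.
    move=> /(zhu_ideal_graded zhu_modeP gamma_natU)[o0 [o1 [oo0 oo1 ho0 ho1 e]]].
    (* Here w0 - w1 = o0 + o1 lies in the ideal. Then w0 - o0 = w1 + o1 is both even and odd, hence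
       zero, and w0 lies in the ideal. *)
    have w0E : w0 = o0.
      apply/eqP; rewrite -subr_eq0; apply/eqP; apply: hint.
        by rewrite -scaleN1r addrC; apply: hL.
      have -> : w0 - o0 = w1 + o1; last exact: hD.
      apply/eqP; rewrite subr_eq -addrA [o1 + _]addrC -e addrC subrK //.
    by rewrite -[RHS](linear0 (cls S)); apply/eq_cls; rewrite subr0 S_ideal w0E.
- move=> x c y z; have [x' ->] := clsP x; have [y' ->] := clsP y; have [z' ->] := clsP z.
  by rewrite -linearP !zhu_mul_cls modeL linearP.
- move=> y c x z; have [x' ->] := clsP x; have [y' ->] := clsP y; have [z' ->] := clsP z.
  by rewrite -linearP !zhu_mul_cls (mode_linl zhu_modeP) linearP.
- move=> x y z; have [x' ->] := clsP x; have [y' ->] := clsP y; have [z' ->] := clsP z.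
  rewrite !zhu_mul_cls; apply/esym/eq_cls; rewrite S_ideal.
  exact: (zhu_mulA zhu_modeP gamma_natU).
- by move=> x; have [x' ->] := clsP x; rewrite zhu_mul_cls (mode1l zhu_modeP) eqxx.
- by move=> x; have [x' ->] := clsP x; rewrite zhu_mul_cls (mode1r zhu_modeP).
- by apply/quot_homP; exists (into (va_one V)) => //; apply/gamma_hom_in/va_one_even.
- move=> p q x y /quot_homP[u hu ->] /quot_homP[v hv ->]; apply/quot_homP.
  by exists (mode (-1) u v); [exact: (mode_hom zhu_modeP)|exact: zhu_mul_cls].
Qed.

Lemma zhu_mul_in a b :
  zhu_mul (cls S (into a)) (cls S (into b)) = cls S (va_bullet γ 1 a b).
Proof. by rewrite zhu_mul_cls va_bulletE. Qed.

End Quotient.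

(** Both spans are the same ideal, so the identity of V[γ] induces maps in both directions, inverse
    to each other. *)
Lemma zhu_quotient_iso (S S' : set W) :
  (forall w, (w \in lspan S) = (w \in zhu_ideal mode)) ->
  (forall w, (w \in lspan S') = (w \in zhu_ideal mode)) ->
  exists f : quot_span S -> quot_span S',
    is_superalgebra_iso (@quot_hom K V γ S) (@quot_hom K V γ S')
      (@zhu_mul S) (@zhu_mul S') (cls S (into (va_one V))) (cls S' (into (va_one V))) f.
Proof.
move=> SO SO'; have clsSS' x y : cls S x = cls S y <-> cls S' x = cls S' y.
  by rewrite !eq_cls SO SO'.
pose f (x : quot_span S) : quot_span S' := cls S' (repr x).
pose g (x : quot_span S') : quot_span S := cls S (repr x).
have fE x : f (cls S x) = cls S' x by apply/clsSS'; exact: reprK.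
have gE x : g (cls S' x) = cls S x by apply/clsSS'; exact: reprK.
exists f; split.
- move=> c x y; have [x' ->] := clsP x; have [y' ->] := clsP y.
  by rewrite -linearP !fE linearP.
- move=> x y; have [x' ->] := clsP x; have [y' ->] := clsP y.
  by rewrite zhu_mul_cls // !fE zhu_mul_cls.
- exact: fE.
- exists g => x; have [x' ->] := clsP x; first by rewrite fE gE.
  by rewrite gE fE.
- move=> p x; split=> [/quot_homP[w hw ->]|].
    by apply/quot_homP; exists w.
  have [x' ->] := clsP x; rewrite fE => /quot_homP[w hw e].
  by apply/quot_homP; exists w => //; apply/clsSS'.
Qed.

End ZhuQuotient.

(** * Comparison of a SUSY vertex algebra with its reduced part *)

Theorem proposition3p6 (R : realType) (N : nat) (N_gt0 : (0 < N)%N)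
    (V : susy_vertex_algebra R[i] N) (γ : gamma_param R[i]) :
  exists mul : sva_zhu V γ -> sva_zhu V γ -> sva_zhu V γ,
    [/\ is_sva_zhu_product mul,
        is_superalgebra (@sva_zhu_hom _ _ V γ) mul (sva_zhu_one V γ)
      & exists (mul_red : va_zhu (reduced V N_gt0) γ ->
                  va_zhu (reduced V N_gt0) γ -> va_zhu (reduced V N_gt0) γ)
               (f : sva_zhu V γ -> va_zhu (reduced V N_gt0) γ),
          [/\ is_va_zhu_product mul_red,
              is_superalgebra (@va_zhu_hom _ (reduced V N_gt0) γ) mul_red
                (va_zhu_one (reduced V N_gt0) γ)
            & is_superalgebra_iso (@sva_zhu_hom _ _ V γ)
                (@va_zhu_hom _ (reduced V N_gt0) γ) mul mul_red
                (sva_zhu_one V γ) (va_zhu_one (reduced V N_gt0) γ) f]].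
Proof.
have charK n : n.+1%:R != 0 :> R[i] by rewrite pnatr_eq0.
pose W := reduced V N_gt0.
have sva_ideal w : (w \in lspan (@sva_zhu_gens _ _ V γ)) =
    (w \in zhu_ideal (coord_mode (@gamma_mode _ W γ) (gamma_val γ))).
  (* The operation •_n of V and that of its reduced part are the same by definition, so all
     generators with n >= 2 fall under the lemma, with k = n - 2. *)
  apply: (@mem_zhu_ideal _ W γ charK) => [a b|_ [n [a [b [n2 ->]]]]].
    by exists 2%N, a, b.
  by exists (n - 2)%N, a, b; rewrite -addn2 subnK.
have va_ideal w : (w \in lspan (@va_zhu_gens _ W γ)) =
    (w \in zhu_ideal (coord_mode (@gamma_mode _ W γ) (gamma_val γ))).
  apply: (@mem_zhu_ideal _ W γ charK) => [a b|_ [a [b ->]]]; first by exists a, b.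
  by exists 0%N, a, b.
have [f f_iso] := @zhu_quotient_iso _ W γ charK (@sva_zhu_gens _ _ V γ) (@va_zhu_gens _ W γ)
  sva_ideal va_ideal.
exists (@zhu_mul _ W γ (@sva_zhu_gens _ _ V γ)); split.
- exact: (@zhu_mul_in _ W γ charK (@sva_zhu_gens _ _ V γ) sva_ideal).
- exact: (@zhu_quotient_superalgebra _ W γ charK (@sva_zhu_gens _ _ V γ) sva_ideal).
exists (@zhu_mul _ W γ (@va_zhu_gens _ W γ)), f; split=> //.
- exact: (@zhu_mul_in _ W γ charK (@va_zhu_gens _ W γ) va_ideal).
- exact: (@zhu_quotient_superalgebra _ W γ charK (@va_zhu_gens _ W γ) va_ideal).
Qed.
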